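(* Let $V$ be a vertex operator algebra of CFT type that is simple and generated in degree zero as a module over itself. Let $d$ be a positive integer and suppose that, for all $0\le j\le d$, $j$ is non-exceptional for $V$ and the $j$-th mode transition algebra $\mathfrak{A}_j$ is strongly unital. Assume further that the Zhu algebra $\mathsf{A}=\mathsf{A}(V)$ is commutative, connected, Noetherian, and that every projective $\mathsf{A}$-module is free. Then, with $D(j)=\dim_{\mathbb{C}}(V_j)$, there are ring isomorphisms $$\mathfrak{A}_j\cong\mathrm{Mat}_{D(j)}(\mathsf{A}(V))\ \ (0\le j\le d),\qquad\text{and thus}\qquad \mathsf{A}_d(V)\cong\prod_{j=0}^d\mathrm{Mat}_{D(j)}(\mathsf{A}(V)),$$ where $\mathsf{A}_d(V)$ is the level-$d$ Zhu algebra of $V$.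
   Context: $V=\bigoplus_{n\in\mathbb{N}}V_n$ is a vertex operator algebra over $\mathbb{C}$ of CFT type ($\mathbb{N}=\mathbb{Z}_{\ge0}$-graded, $\dim V_n<\infty$, $\dim V_0=1$) with conformal vector $\omega$, $Y(\omega,z)=\sum L_nz^{-n-2}$. Universal enveloping algebra: $\mathscr{U}=\bigoplus_{k\in\mathbb{Z}}\mathscr{U}_k$ is the graded unital associative algebra topologically generated by symbols $a_{[n]}$ ($a\in V$, $n\in\mathbb{Z}$, linear in $a$), with $a_{[n]}$ of degree $\deg a-n-1$ for homogeneous $a$. It is obtained from the universal enveloping algebra of the Lie algebra $(V\otimes\mathbb{C}[t,t^{-1}])/\mathrm{im}(L_{-1}\otimes1+1\otimes\tfrac{d}{dt})$, where $a_{[n]}$ is the class of $a\otimes t^n$ and $[a_{[m]},b_{[n]}]=\sum_{j\ge0}\binom mj(a_{(j)}b)_{[m+n-j]}$, by completing each graded piece with respect to the subspaces (left ideal generated by degrees $\le -N$), $N\to\infty$, and imposing $\mathbf{1}_{[-1]}=1$ and $(a_{(-1)}b)_{[n]}=\sum_{j<0}a_{[j]}b_{[n-j-1]}+\sum_{j\ge0}b_{[n-j-1]}a_{[j]}$. Write $\mathscr{U}_{\le-m}=\bigoplus_{k\le-m}\mathscr{U}_k$, $\mathscr{U}_{\ge1}=\bigoplus_{k\ge1}\mathscr{U}_k$. An $\mathbb{N}$-graded (admissible) $V$-module is a weak $V$-module $W=\bigoplus_{d\in\mathbb{N}}W_d$ with $a_{(n)}W_d\subseteq W_{d+\deg a-n-1}$;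 $\mathscr{U}$ acts via $a_{[n]}\mapsto a_{(n)}$. Zhu algebras: $\mathsf{A}=\mathscr{U}_0/(\mathscr{U}\cdot\mathscr{U}_{\le-1})_0$ and, for $d\ge0$, $\mathsf{A}_d(V)=\mathscr{U}_0/(\mathscr{U}\cdot\mathscr{U}_{\le-d-1})_0$; these are canonically isomorphic to Zhu's algebra and to the level-$d$ Zhu algebra of Dong–Li–Mason. ''Connected'' means no idempotents other than $0,1$. Induction: for a left $\mathsf{A}$-module $\mathsf{M}$, $\Phi^{\mathsf L}(\mathsf{M})=(\mathscr{U}/\mathscr{U}\cdot\mathscr{U}_{\le-1})\otimes_{\mathscr{U}_0}\mathsf{M}$, an $\mathbb{N}$-graded module with degree-$0$ part $\mathsf{M}$. For a right $\mathsf{A}$-module $\mathsf{N}$, $\Phi^{\mathsf R}(\mathsf{N})=\mathsf{N}\otimes_{\mathscr{U}_0}(\mathscr{U}/\mathscr{U}_{\ge1}\cdot\mathscr{U})$, graded in degrees $\le0$. A module $W$ is generated in degree $0$ if the natural map $\Phi^{\mathsf L}(W_0)\to W$ is surjective. Mode transition algebra: $\mathfrak{A}=\Phi^{\mathsf L}(\mathsf{A})\otimes_{\mathsf{A}}\Phi^{\mathsf R}(\mathsf{A})=\bigoplus_{i,j\in\mathbb{N}}\mathfrak{A}_{i,-j}$, $\mathfrak{A}_{i,-j}=\Phi^{\mathsf L}(\mathsf{A})_i\otimes_{\mathsf{A}}\Phi^{\mathsf R}(\mathsf{A})_{-j}$, with product $(x\otimes\beta)\star(\alpha\otimes y)=x\otimes\langle\beta,\alpha\rangle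 y$, where for $\beta=b\otimes v\in\Phi^{\mathsf R}(\mathsf{A})$, $\alpha=u\otimes a\in\Phi^{\mathsf L}(\mathsf{A})$ ($u,v$ homogeneous), $\langle\beta,\alpha\rangle=b\,[vu]\,a\in\mathsf{A}$ with $[vu]$ the class of $vu$ in $\mathsf{A}$ if $\deg u+\deg v=0$, and $0$ otherwise. $\mathfrak{A}_j:=\mathfrak{A}_{j,-j}$ is the $j$-th mode transition algebra. It is strongly unital if there is $1_j\in\mathfrak{A}_j$ with $x\star1_j=x$ for all $x\in\mathfrak{A}_{0,-j}$ and $1_j\star y=y$ for all $y\in\mathfrak{A}_{j,0}$. $j$ is non-exceptional for $V$ if $\Phi^{\mathsf L}(\mathsf{A})_j\ne0$; equivalently, if there is an $\mathbb{N}$-graded $V$-module $W$ generated in degree $0$ with $W_j\neq0$. *)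

(* Defs.v *)
From HB Require Import structures.
From mathcomp Require Import all_boot all_order all_algebra complex.
From mathcomp Require Import boolp classical_sets functions reals.
From mathcomp Require Import ring zify.

Set Implicit Arguments.
Unset Strict Implicit.
Unset Printing Implicit Defensive.
Import Order.TTheory GRing.Theory Num.Theory.
Local Open Scope ring_scope.
Local Open Scope quotient_scope.

Record zsetoid := ZSetoid {
  zs_car : Type;
  zs_eq : zs_car -> zs_car -> Prop;
  zs_zero : zs_car;
  zs_opp : zs_car -> zs_car;
  zs_add : zs_car -> zs_car -> zs_car;
  zs_refl : forall x, zs_eq x x;
  zs_sym : forall x y, zs_eq x y -> zs_eq y x;
  zs_trans : forall x y z, zs_eq x y -> zs_eq y z -> zs_eq x z;
  zs_oppE : forall x y, zs_eq x y -> zs_eq (zs_opp x) (zs_opp y);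
  zs_addE : forall x x' y y', zs_eq x x' -> zs_eq y y' ->
    zs_eq (zs_add x y) (zs_add x' y');
  zs_addA : forall x y z,
    zs_eq (zs_add x (zs_add y z)) (zs_add (zs_add x y) z);
  zs_addC : forall x y, zs_eq (zs_add x y) (zs_add y x);
  zs_add0 : forall x, zs_eq (zs_add zs_zero x) x;
  zs_addN : forall x, zs_eq (zs_add (zs_opp x) x) zs_zero
}.

Section ZQuot.
Variable S : zsetoid.
Definition zs_rel : rel {classic zs_car S} := fun x y => `[< zs_eq x y >].

Lemma zs_rel_refl : reflexive zs_rel.
Proof. by move=> x; apply/asboolP/zs_refl. Qed.
Lemma zs_rel_sym : symmetric zs_rel.
Proof. by move=> x y; apply/asboolP/asboolP => /zs_sym. Qed.
Lemma zs_rel_trans : transitive zs_rel.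
Proof.
move=> y x z /asboolP xy /asboolP yz; apply/asboolP.
exact: zs_trans xy yz.
Qed.

Canonical zs_equiv := EquivRel zs_rel zs_rel_refl zs_rel_sym zs_rel_trans.

Definition zquot : Type := {eq_quot zs_rel}.
HB.instance Definition _ := Choice.on zquot.

Definition zpi (x : zs_car S) : zquot := \pi_{eq_quot zs_rel} x.
Definition zrepr (q : zquot) : zs_car S := repr (q : {eq_quot zs_rel}).

Lemma zreprK q : zpi (zrepr q) = q. Proof. exact: reprK. Qed.
Lemma zpiP x y : zpi x = zpi y <-> zs_eq x y.
Proof. by split=> [/eqmodP/asboolP|e]; last exact/eqmodP/asboolP. Qed.
Lemma zpi_repr x : zs_eq (zrepr (zpi x)) x.
Proof. by apply/zpiP; rewrite zreprK. Qed.

Definition zq_opp p := zpi (zs_opp (zrepr p)).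
Definition zq_add p q := zpi (zs_add (zrepr p) (zrepr q)).

Lemma zq_oppE x : zq_opp (zpi x) = zpi (zs_opp x).
Proof. exact/zpiP/zs_oppE/zpi_repr. Qed.
Lemma zq_addE x y : zq_add (zpi x) (zpi y) = zpi (zs_add x y).
Proof. by apply/zpiP/zs_addE; exact: zpi_repr. Qed.

Lemma zq_addA : associative zq_add.
Proof.
move=> p q r; rewrite -(zreprK p) -(zreprK q) -(zreprK r) !zq_addE.
exact/zpiP/zs_addA.
Qed.
Lemma zq_addC : commutative zq_add.
Proof.
by move=> p q; rewrite -(zreprK p) -(zreprK q) !zq_addE; apply/zpiP/zs_addC.
Qed.
Lemma zq_add0 : left_id (zpi (zs_zero S)) zq_add.
Proof. by move=> p; rewrite -(zreprK p) !zq_addE; apply/zpiP/zs_add0. Qed.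
Lemma zq_addN : left_inverse (zpi (zs_zero S)) zq_opp zq_add.
Proof.
by move=> p; rewrite -(zreprK p) zq_oppE zq_addE; apply/zpiP/zs_addN.
Qed.

HB.instance Definition _ :=
  GRing.isZmodule.Build zquot zq_addA zq_addC zq_add0 zq_addN.

Lemma zpi0 : zpi (zs_zero S) = 0. Proof. by []. Qed.
Lemma zpiN x : zpi (zs_opp x) = - zpi x.
Proof. by rewrite -zq_oppE. Qed.
Lemma zpiD x y : zpi (zs_add x y) = zpi x + zpi y.
Proof. by rewrite -zq_addE. Qed.
End ZQuot.

Record rsetoid := RSetoid {
  rs_zsetoid :> zsetoid;
  rs_one : zs_car rs_zsetoid;
  rs_mul : zs_car rs_zsetoid -> zs_car rs_zsetoid -> zs_car rs_zsetoid;
  rs_mulE : forall x x' y y', zs_eq x x' -> zs_eq y y' ->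
    zs_eq (rs_mul x y) (rs_mul x' y');
  rs_mulA : forall x y z,
    zs_eq (rs_mul x (rs_mul y z)) (rs_mul (rs_mul x y) z);
  rs_mul1l : forall x, zs_eq (rs_mul rs_one x) x;
  rs_mul1r : forall x, zs_eq (rs_mul x rs_one) x;
  rs_mulDl : forall x y z,
    zs_eq (rs_mul (zs_add x y) z) (zs_add (rs_mul x z) (rs_mul y z));
  rs_mulDr : forall x y z,
    zs_eq (rs_mul x (zs_add y z)) (zs_add (rs_mul x y) (rs_mul x z))
}.

Section RQuot.
Variable S : rsetoid.
Definition rquot : Type := zquot S.
HB.instance Definition _ := GRing.Zmodule.on rquot.

Definition rpi (x : zs_car S) : rquot := zpi x.
Lemma rreprK (q : rquot) : rpi (zrepr q) = q. Proof. exact: zreprK. Qed.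
Lemma rpiD x y : rpi (zs_add x y) = rpi x + rpi y. Proof. exact: zpiD. Qed.
Definition rq_mul (p q : rquot) : rquot := rpi (rs_mul (zrepr p) (zrepr q)).

Lemma rq_mulE x y : rq_mul (rpi x) (rpi y) = rpi (rs_mul x y).
Proof. by apply/zpiP/rs_mulE; exact: zpi_repr. Qed.
Lemma rq_mulA : associative rq_mul.
Proof.
move=> p q r; rewrite -(rreprK p) -(rreprK q) -(rreprK r) !rq_mulE.
by apply/zpiP; exact: rs_mulA.
Qed.
Lemma rq_mul1l : left_id (rpi (rs_one S)) rq_mul.
Proof. by move=> p; rewrite -(rreprK p) !rq_mulE; apply/zpiP; exact: rs_mul1l. Qed.
Lemma rq_mul1r : right_id (rpi (rs_one S)) rq_mul.
Proof. by move=> p; rewrite -(rreprK p) !rq_mulE; apply/zpiP; exact: rs_mul1r. Qed.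
Lemma rq_mulDl : left_distributive rq_mul +%R.
Proof.
move=> p q r; rewrite -(rreprK p) -(rreprK q) -(rreprK r).
rewrite -rpiD !rq_mulE -rpiD; by apply/zpiP; exact: rs_mulDl.
Qed.
Lemma rq_mulDr : right_distributive rq_mul +%R.
Proof.
move=> p q r; rewrite -(rreprK p) -(rreprK q) -(rreprK r).
rewrite -rpiD !rq_mulE -rpiD; by apply/zpiP; exact: rs_mulDr.
Qed.

HB.instance Definition _ := GRing.Zmodule_isPzRing.Build rquot
  rq_mulA rq_mul1l rq_mul1r rq_mulDl rq_mulDr.

Lemma rpiM x y : rpi (rs_mul x y) = rpi x * rpi y.
Proof. by rewrite -rq_mulE. Qed.
Lemma rpi1 : rpi (rs_one S) = 1. Proof. by []. Qed.
End RQuot.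

Definition subgroup (S : zmodType) (A : set S) : Prop :=
  A 0 /\ forall x y, A x -> A y -> A (x - y).

Section Subgroup.
Variables (S : zmodType) (A : set S).
Hypothesis sA : subgroup A.
Lemma subgroup0 : A 0. Proof. by case: sA. Qed.
Lemma subgroupB x y : A x -> A y -> A (x - y). Proof. by case: sA => _; apply. Qed.
Lemma subgroupN x : A x -> A (- x).
Proof. by move=> Ax; rewrite -(sub0r x); apply: subgroupB => //; exact: subgroup0. Qed.
Lemma subgroupD x y : A x -> A y -> A (x + y).
Proof. by move=> Ax Ay; rewrite -(opprK y); apply/subgroupB/subgroupN. Qed.
Lemma subgroup_sum n (f : 'I_n -> S) : (forall i, A (f i)) -> A (\sum_i f i).
Proof. by move=> Af; apply: big_ind => //; [exact: subgroup0|exact: subgroupD]. Qed.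
End Subgroup.

(* [A / (A :&: I)] for two subgroups [A] and [I] of [S] *)
Section SubQuot.
Variables (S : zmodType) (A I : set S).
Hypotheses (sA : subgroup A) (sI : subgroup I).
Let T := {x : S | A x}.
Let eqT (x y : T) := I (sval x - sval y).
Let zeroT : T := exist _ 0 (subgroup0 sA).
Let oppT (x : T) : T := exist _ (- sval x) (subgroupN sA (svalP x)).
Let addT (x y : T) : T :=
  exist _ (sval x + sval y) (subgroupD sA (svalP x) (svalP y)).

Definition subquot_setoid : zsetoid.
Proof.
refine (@ZSetoid T eqT zeroT oppT addT _ _ _ _ _ _ _ _ _); rewrite /eqT /=.
- by move=> x; rewrite subrr; exact: subgroup0.
- by move=> x y; rewrite -opprB => h; rewrite -(opprK (_ - _)); exact: subgroupN.
- move=> x y z xy yz; rewrite -(subrKA (sval y)); exact: subgroupD.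
- by move=> x y h; rewrite -opprD; exact: subgroupN.
- by move=> x x' y y' h k; rewrite opprD addrACA; exact: subgroupD.
- by move=> x y z; rewrite addrA subrr; exact: subgroup0.
- by move=> x y; rewrite (addrC (sval x)) subrr; exact: subgroup0.
- by move=> x; rewrite add0r subrr; exact: subgroup0.
- by move=> x; rewrite addNr subrr; exact: subgroup0.
Defined.
End SubQuot.

(* [A / (A :&: I)] for a subring [A] of [S] and an ideal [I] *)
Section RSubQuot.
Variables (S : pzRingType) (A I : set S).
Hypotheses (sA : subgroup A) (sI : subgroup I).
Hypotheses (A1 : A 1) (AM : forall x y, A x -> A y -> A (x * y)).
Hypotheses (IMl : forall x y, A x -> I y -> I (x * y))
           (IMr : forall x y, I x -> A y -> I (x * y)).
Let Z := subquot_setoid sA sI.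
Let oneT : zs_car Z := exist _ 1 A1.
Let mulT (x y : zs_car Z) : zs_car Z :=
  exist _ (sval x * sval y) (AM (svalP x) (svalP y)).

Definition rsubquot_setoid : rsetoid.
Proof.
refine (@RSetoid Z oneT mulT _ _ _ _ _ _) => /=.
- move=> [x Ax] [x' Ax'] [y Ay] [y' Ay'] /= xx' yy'.
  have -> : x * y - x' * y' = x * (y - y') + (x - x') * y'.
    by rewrite mulrBr mulrBl addrA subrK.
  by apply: (subgroupD sI); [exact: IMl|exact: IMr].
- by move=> x y z; rewrite mulrA subrr; exact: subgroup0.
- by move=> x; rewrite mul1r subrr; exact: subgroup0.
- by move=> x; rewrite mulr1 subrr; exact: subgroup0.
- by move=> x y z; rewrite mulrDl subrr; exact: subgroup0.
- by move=> x y z; rewrite mulrDr subrr; exact: subgroup0.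
Defined.
End RSubQuot.

(* [P (x)_S Q], where [S] acts on the right of [P] by [ra] and on the left of
   [Q] by [la]: formal sums of pairs modulo the bilinearity and balancing
   relations. *)
Section Tensor.
Variables (P Q : zmodType) (S : Type) (ra : P -> S -> P) (la : S -> Q -> Q).

Inductive tens_eq : seq (P * Q) -> seq (P * Q) -> Prop :=
| tens_refl s : tens_eq s s
| tens_sym s t : tens_eq s t -> tens_eq t s
| tens_trans s t r : tens_eq s t -> tens_eq t r -> tens_eq s r
| tens_cat s s' t t' :
    tens_eq s s' -> tens_eq t t' -> tens_eq (s ++ t) (s' ++ t')
| tens_catC s t : tens_eq (s ++ t) (t ++ s)
| tens_Dl p p' q : tens_eq [:: (p + p', q)] [:: (p, q); (p', q)]
| tens_Dr p q q' : tens_eq [:: (p, q + q')] [:: (p, q); (p, q')]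
| tens_0l q : tens_eq [:: (0, q)] [::]
| tens_bal p s q : tens_eq [:: (ra p s, q)] [:: (p, la s q)].

Definition tens_setoid : zsetoid.
Proof.
refine (@ZSetoid (seq (P * Q)) tens_eq [::]
  (map (fun z => (- z.1, z.2))) cat
  tens_refl tens_sym tens_trans _ tens_cat _ tens_catC _ _).
- move=> s t; elim=> {s t} /=.
  + by move=> s; exact: tens_refl.
  + by move=> s t _; exact: tens_sym.
  + by move=> s t r _ h _; exact: tens_trans.
  + by move=> s s' t t' _ h _ k; rewrite !map_cat; exact: tens_cat.
  + by move=> s t; rewrite !map_cat; exact: tens_catC.
  + by move=> p p' q; rewrite opprD; exact: tens_Dl.
  + by move=> p q q'; exact: tens_Dr.
  + by move=> q; rewrite oppr0; exact: tens_0l.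
  + move=> p s q.
    have N (x : P) (y : Q) : tens_eq ([:: (- x, y)] ++ [:: (x, y)]) [::].
      apply: tens_trans (tens_sym (tens_Dl _ _ _)) _.
      by rewrite addNr; exact: tens_0l.
    apply: (@tens_trans _ ([:: (- ra p s, q)] ++ ([:: (p, la s q)] ++ [:: (- p, la s q)]))).
      rewrite -{1}(cats0 [:: _]); apply: tens_cat; first exact: tens_refl.
      by apply: tens_sym; apply: tens_trans (tens_catC _ _) (N _ _).
    rewrite catA -[X in tens_eq _ X]cat0s.
    apply: tens_cat; last exact: tens_refl.
    apply: tens_trans (N (ra p s) q).
    apply: tens_cat; first exact: tens_refl.
    exact/tens_sym/tens_bal.
- by move=> s t r; rewrite catA; exact: tens_refl.
- by move=> s; exact: tens_refl.
- elim=> [|[p q] s IHs] /=; first exact: tens_refl.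
  apply: (@tens_trans _ (([:: (- p, q)] ++ [:: (p, q)]) ++
                         ([seq (- z.1, z.2) | z <- s] ++ s))).
    rewrite -catA -[X in tens_eq X _]cat1s.
    apply: tens_cat; first exact: tens_refl.
    rewrite catA; rewrite -(cat1s _ s) catA.
    apply: tens_cat; [exact: tens_catC|exact: tens_refl].
  rewrite -[X in tens_eq _ X]cats0; apply: tens_cat => //.
  apply: tens_trans (tens_sym (tens_Dl _ _ _)) _.
  by rewrite addNr; exact: tens_0l.
Defined.

Definition tensor : Type := zquot tens_setoid.
HB.instance Definition _ := GRing.Zmodule.on tensor.

Definition pure (p : P) (q : Q) : tensor := @zpi tens_setoid [:: (p, q)].

Definition balanced (G : zmodType) (f : P -> Q -> G) : Prop :=
  [/\ forall p p' q, f (p + p') q = f p q + f p' q,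
      forall p q q', f p (q + q') = f p q + f p q'
    & forall p s q, f (ra p s) q = f p (la s q)].

(* The map out of the tensor product induced by [f]; meaningful when [f] is
   balanced, see [tlift_pure]. *)
Definition tlift (G : zmodType) (f : P -> Q -> G) (t : tensor) : G :=
  \sum_(z <- (zrepr t : seq (P * Q))) f z.1 z.2.

Section Lift.
Variables (G : zmodType) (f : P -> Q -> G).
Hypothesis bf : balanced f.

Lemma tlift_eq s t : tens_eq s t ->
  \sum_(z <- s) f z.1 z.2 = \sum_(z <- t) f z.1 z.2.
Proof.
case: bf => fDl fDr fb; elim=> {s t} //.
- by move=> s t r _ -> _ ->.
- by move=> s s' t t' _ h _ k; rewrite !big_cat /= h k.
- by move=> s t; rewrite !big_cat /= addrC.
- by move=> p p' q; rewrite !(big_cons, big_nil) /= !addr0.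
- by move=> p q q'; rewrite !(big_cons, big_nil) /= !addr0.
- move=> q; rewrite !(big_cons, big_nil) /= addr0.
  by apply: (addrI (f 0 q)); rewrite -fDl !addr0.
- by move=> p s q; rewrite !(big_cons, big_nil) /= !addr0.
Qed.

Lemma tlift_pi s : tlift f (@zpi tens_setoid s) = \sum_(z <- s) f z.1 z.2.
Proof. by apply: tlift_eq; exact: (@zpi_repr tens_setoid s). Qed.
Lemma tlift_pure p q : tlift f (pure p q) = f p q.
Proof. by rewrite tlift_pi big_cons big_nil addr0. Qed.
Lemma tliftD s t : tlift f (s + t) = tlift f s + tlift f t.
Proof. by rewrite -(zreprK s) -(zreprK t) -zpiD !tlift_pi big_cat. Qed.
End Lift.

Lemma pureDl p p' q : pure (p + p') q = pure p q + pure p' q.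
Proof. by rewrite -zpiD; exact/zpiP/tens_Dl. Qed.
Lemma pureDr p q q' : pure p (q + q') = pure p q + pure p q'.
Proof. by rewrite -zpiD; exact/zpiP/tens_Dr. Qed.
Lemma pure_bal p s q : pure (ra p s) q = pure p (la s q).
Proof. exact/zpiP/tens_bal. Qed.

Lemma tensor_ind (K : tensor -> Prop) : K 0 ->
  (forall p q t, K t -> K (pure p q + t)) -> forall t, K t.
Proof.
move=> K0 KD t; rewrite -(zreprK t); elim: (zrepr t : seq _) => [//|[p q] s IH].
by have := KD p q _ IH; rewrite -zpiD.
Qed.

Lemma tensor_ext (G : zmodType) (f g : tensor -> G) :
  (forall s t, f (s + t) = f s + f t) -> (forall s t, g (s + t) = g s + g t) ->
  (forall p q, f (pure p q) = g (pure p q)) -> f =1 g.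
Proof.
move=> fD gD fg; apply: tensor_ind => [|p q t IH]; last by rewrite fD gD fg IH.
have z (h : tensor -> G) : (forall s t, h (s + t) = h s + h t) -> h 0 = 0.
  by move=> hD; apply: (addrI (h 0)); rewrite -hD !addr0.
by rewrite !z.
Qed.
End Tensor.

Definition zbinom (C : numFieldType) (m : int) (j : nat) : C :=
  (\prod_(i < j) (m%:~R - i%:R)) / j`!%:R.

(* Vertex operator algebras of CFT type. The space is the internal direct sum
   of the finite-dimensional spaces [piece n]; [md a n b] is a_(n) b.
   In [borcherds], all the terms of index [>= N] of the three sums vanish. *)
Record voa (C : numFieldType) := Voa {
  vspace_of :> lmodType C;
  piece : nat -> vectType C;
  inj : forall n, {linear piece n -> vspace_of};
  proj : forall n, {linear vspace_of -> piece n};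
  injK : forall n x, proj n (inj n x) = x;
  proj_inj0 : forall m n x, m != n -> proj m (inj n x) = 0;
  sum_proj : forall v, exists N, v = \sum_(n < N) inj n (proj n v);
  dim_piece0 : \dim {: piece 0} = 1%N;
  md : vspace_of -> int -> vspace_of -> vspace_of;
  md_linl : forall n b c a a',
    md (c *: a + a') n b = c *: md a n b + md a' n b;
  md_linr : forall a n c b b',
    md a n (c *: b + b') = c *: md a n b + md a n b';
  md_trunc : forall a b, exists N : nat, forall j : nat,
    (N <= j)%N -> md a j%:Z b = 0;
  md_deg : forall p q (x : piece p) (y : piece q) (n : int) (r : nat),
    r%:Z != p%:Z + q%:Z - n - 1 -> proj r (md (inj p x) n (inj q y)) = 0;
  vac : vspace_of;
  vac_deg : exists x, vac = inj 0 x;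
  md_vac : forall n b, md vac n b = if n == -1 then b else 0;
  md_creation : forall a, md a (-1) vac = a;
  md_creation0 : forall a (n : nat), md a n%:Z vac = 0;
  borcherds : forall a b c (m n k : int) (N : nat),
    (forall j : nat, (N <= j)%N -> md a (n + j%:Z) b = 0) ->
    (forall j : nat, (N <= j)%N -> md a (m + j%:Z) c = 0) ->
    (forall j : nat, (N <= j)%N -> md b (k + j%:Z) c = 0) ->
    \sum_(j < N) zbinom C m j *: md (md a (n + j%:Z) b) (m + k - j%:Z) c
    = \sum_(j < N) ((-1) ^+ j * zbinom C n j) *:
        (md a (m + n - j%:Z) (md b (k + j%:Z) c)
         - ((-1) ^ n) *: md b (n + k - j%:Z) (md a (m + j%:Z) c));
  conf : vspace_of;
  conf_deg : exists x, conf = inj 2 x;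
  central_charge : C;
  virasoro : forall (m n : int) v,
    md conf (m + 1) (md conf (n + 1) v) - md conf (n + 1) (md conf (m + 1) v)
    = (m - n)%:~R *: md conf (m + n + 1) v
      + (if m + n == 0 then (m ^+ 3 - m)%:~R / 12%:R * central_charge else 0)
        *: v;
  L0_deg : forall n x, md conf 1 (inj n x) = n%:R *: inj n x;
  Lm1_der : forall a (n : int) b,
    md (md conf 0 a) n b = - n%:~R *: md a (n - 1) b
}.

Arguments inj {C _} n.
Arguments proj {C _} n.
Arguments md {C _}.
Arguments vac {C _}.
Arguments conf {C _}.

Section VOA.
Variables (C : numFieldType) (V : voa C).

Definition simple_voa : Prop :=
  (exists v : V, v <> 0) /\
  forall W : set V,
    W 0 -> (forall c x y, W x -> W y -> W (c *: x + y)) ->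
    (forall a n x, W x -> W (md a n x)) ->
    (forall x, W x -> x = 0) \/ (forall x, W x).

(* [tgen a n] is the symbol a_[n]; [tsc] embeds the scalars. *)
Inductive term :=
| tsc of C
| tgen of V & int
| tadd of term & term
| tmul of term & term.

Definition tsum (s : seq term) : term := foldr tadd (tsc 0) s.

Inductive teq : term -> term -> Prop :=
| teq_refl x : teq x x
| teq_sym x y : teq x y -> teq y x
| teq_trans x y z : teq x y -> teq y z -> teq x z
| teq_add x x' y y' : teq x x' -> teq y y' -> teq (tadd x y) (tadd x' y')
| teq_mul x x' y y' : teq x x' -> teq y y' -> teq (tmul x y) (tmul x' y')
| teq_addA x y z : teq (tadd x (tadd y z)) (tadd (tadd x y) z)
| teq_addC x y : teq (tadd x y) (tadd y x)
| teq_add0 x : teq (tadd (tsc 0) x) x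
| teq_addN x : teq (tadd (tmul (tsc (-1)) x) x) (tsc 0)
| teq_mulA x y z : teq (tmul x (tmul y z)) (tmul (tmul x y) z)
| teq_mul1 x : teq (tmul (tsc 1) x) x
| teq_mulDl x y z : teq (tmul (tadd x y) z) (tadd (tmul x z) (tmul y z))
| teq_mulDr x y z : teq (tmul x (tadd y z)) (tadd (tmul x y) (tmul x z))
| teq_scD c c' : teq (tsc (c + c')) (tadd (tsc c) (tsc c'))
| teq_scM c c' : teq (tsc (c * c')) (tmul (tsc c) (tsc c'))
| teq_scC c x : teq (tmul (tsc c) x) (tmul x (tsc c))
| teq_genD a b n : teq (tgen (a + b) n) (tadd (tgen a n) (tgen b n))
| teq_genZ c a n : teq (tgen (c *: a) n) (tmul (tsc c) (tgen a n))
| teq_der a n :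
    teq (tadd (tgen (md conf 0 a) n) (tmul (tsc n%:~R) (tgen a (n - 1))))
        (tsc 0)
| teq_bracket a b (m n : int) (N : nat) :
    (forall j : nat, (N <= j)%N -> md a j%:Z b = 0) ->
    teq (tmul (tgen a m) (tgen b n))
        (tadd (tmul (tgen b n) (tgen a m))
           (tsum [seq tmul (tsc (zbinom C m j))
                           (tgen (md a j%:Z b) (m + n - j%:Z))
                 | j <- iota 0 N])).

Definition term_zsetoid : zsetoid.
Proof.
refine (@ZSetoid term teq (tsc 0) (tmul (tsc (-1))) tadd
  teq_refl teq_sym teq_trans _ teq_add teq_addA teq_addC teq_add0 teq_addN).
by move=> x y; apply: teq_mul; exact: teq_refl.
Defined.

Definition term_setoid : rsetoid.
Proof.
refine (@RSetoid term_zsetoid (tsc 1) tmul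
  teq_mul teq_mulA teq_mul1 _ teq_mulDl teq_mulDr).
by move=> x; apply: teq_trans (teq_mul1 x); exact/teq_sym/teq_scC.
Defined.

(* the (uncompleted) universal enveloping algebra of
   (V (x) C[t,1/t]) / im (L_{-1} (x) 1 + 1 (x) d/dt) *)
Definition ufin : Type := rquot term_setoid.
HB.instance Definition _ := GRing.PzRing.on ufin.

Definition uterm (x : term) : ufin := @rpi term_setoid x.
Definition usc (c : C) : ufin := uterm (tsc c).
Definition ugen (a : V) (n : int) : ufin := uterm (tgen a n).

Inductive uhom : int -> ufin -> Prop :=
| uhom_0 k : uhom k 0
| uhom_sc c : uhom 0 (usc c)
| uhom_gen p (x : piece V p) n : uhom (p%:Z - n - 1) (ugen (inj p x) n)
| uhom_D k x y : uhom k x -> uhom k y -> uhom k (x + y)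
| uhom_M k l x y : uhom k x -> uhom l y -> uhom (k + l) (x * y).

End VOA.

Section GradedIdeals.
Variables (S : pzRingType) (H : int -> set S).

(* the degree-[k] part of the left ideal [S * S_{<= m}] *)
Definition lideal (m k : int) : set S := [set x | exists (n : nat)
  (l : 'I_n -> int) (u v : 'I_n -> S),
  (forall i, [/\ (l i <= m)%R, H (k - l i) (u i) & H (l i) (v i)])
  /\ x = \sum_i u i * v i].

(* the degree-[k] part of the right ideal [S_{>= m} * S] *)
Definition rideal (m k : int) : set S := [set x | exists (n : nat)
  (l : 'I_n -> int) (u v : 'I_n -> S),
  (forall i, [/\ (m <= l i)%R, H (l i) (u i) & H (k - l i) (v i)])
  /\ x = \sum_i u i * v i].

Lemma ridealE m k : rideal m k = lideal (k - m) k.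
Proof.
apply/seteqP; split=> x [n [l [u [v [h ->]]]]];
  exists n, (fun i => k - l i), u, v; split=> // i; have [h1 h2 h3] := h i.
- by split=> //; [lia|rewrite opprB addrC subrK].
- by split=> //; [lia|rewrite opprB addrC subrK].
Qed.

Hypotheses (sH : forall k, subgroup (H k)) (H1 : H 0 1)
  (HM : forall k l x y, H k x -> H l y -> H (k + l) (x * y)).

Lemma lideal_sub m k x : lideal m k x -> H k x.
Proof.
case=> n [l [u [v [h ->]]]]; apply: subgroup_sum => // i.
by have [_ hu hv] := h i; have := HM hu hv; rewrite subrK.
Qed.

Lemma lidealS m m' k x : (m <= m')%R -> lideal m k x -> lideal m' k x.
Proof.
move=> mm' [n [l [u [v [h ->]]]]]; exists n, l, u, v; split=> // i.
by have [h1 h2 h3] := h i; split=> //; exact: le_trans h1 mm'.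
Qed.

Lemma lideal_subgroup m k : subgroup (lideal m k).
Proof.
split.
  exists 0%N, (fun=> 0), (fun=> 0), (fun=> 0); rewrite big_ord0; split=> // -[] //.
move=> x y [n [l [u [v [h ->]]]]] [n' [l' [u' [v' [h' ->]]]]].
pose glue (T : Type) (f : 'I_n -> T) (g : 'I_n' -> T) (i : 'I_(n + n')) :=
  match fintype.split i with inl j => f j | inr j => g j end.
exists (n + n')%N, (glue _ l l'), (glue _ u (fun j => - u' j)), (glue _ v v').
split.
  move=> i; rewrite /glue; case: (fintype.split i) => j; first exact: h.
  by have [h1 h2 h3] := h' j; split=> //; exact: subgroupN.
rewrite big_split_ord /= -sumrN; congr (_ + _); apply: eq_bigr => i _.
  by rewrite /glue (unsplitK (inl i)).
by rewrite /glue (unsplitK (inr i)) mulNr.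
Qed.

Lemma lideal_mull m k p u x : H p u -> lideal m k x -> lideal m (p + k) (u * x).
Proof.
move=> hu [n [l [w [v [h ->]]]]]; exists n, l, (fun i => u * w i), v; split.
  move=> i; have [h1 h2 h3] := h i; split=> //.
  by rewrite -addrA; exact: HM.
by rewrite mulr_sumr; apply: eq_bigr => i _; rewrite mulrA.
Qed.

Lemma lideal_mulr m k q v x :
  H q v -> lideal m k x -> lideal (m + q) (k + q) (x * v).
Proof.
move=> hv [n [l [u [w [h ->]]]]].
exists n, (fun i => l i + q), u, (fun i => w i * v); split.
  move=> i; have [h1 h2 h3] := h i; split; first by rewrite lerD2r.
    by rewrite opprD addrACA subrr addr0.
  exact: HM.
by rewrite mulr_suml; apply: eq_bigr => i _; rewrite mulrA.
Qed.
End GradedIdeals.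

Section ModeAlgebra.
Variables (C : numFieldType) (V : voa C).
Local Notation U := (ufin V).
Local Notation uhom := (@uhom C V).

Lemma uhomN k x : uhom k x -> uhom k (- x).
Proof.
move=> h.
have -> : - x = usc V (-1) * x.
  rewrite -{1}(rreprK x) -[LHS](@zpiN (term_zsetoid V)).
  rewrite -{2}(rreprK x); exact: (@rpiM (term_setoid V) (tsc V (-1))).
by rewrite -(add0r k); apply: uhom_M => //; exact: uhom_sc.
Qed.

Lemma uhom_subgroup k : subgroup (uhom k).
Proof.
split; first exact: uhom_0.
by move=> x y hx hy; apply: uhom_D => //; exact: uhomN.
Qed.

Lemma uhom1 : uhom 0 1. Proof. exact: (uhom_sc V 1). Qed.

(* Cauchy sequences in [U_k] for the filtration by the degree-[k] parts of the
   left ideals [U * U_{<= -N}] *)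
Definition cauchy (k : int) : set (nat -> U) := [set x |
  (forall n, uhom k (x n)) /\
  forall N : int, exists n0 : nat, forall p q : nat, (n0 <= p)%N -> (n0 <= q)%N ->
    lideal uhom (- N) k (x p - x q)].

Definition eventually_in (m k : int) : set (nat -> U) := [set x |
  exists n0 : nat, forall n : nat, (n0 <= n)%N -> lideal uhom m k (x n)].

(* finite sums of homogeneous Cauchy sequences *)
Inductive cseq : set (nat -> U) :=
| cseq_hom k x : cauchy k x -> cseq x
| cseq_D x y : cseq x -> cseq y -> cseq (x + y).

Lemma cauchy_subgroup k : subgroup (cauchy k).
Proof.
split.
  split=> [n|N]; first exact: uhom_0.
  exists 0%N => p q _ _; rewrite subrr.
  exact: subgroup0 (lideal_subgroup uhom_subgroup _ _).
move=> x y [hx cx] [hy cy]; split=> [n|N].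
  by apply: (subgroupB (uhom_subgroup k)).
have [n1 h1] := cx N; have [n2 h2] := cy N.
exists (maxn n1 n2) => p q; rewrite !geq_max => /andP[p1 p2] /andP[q1 q2].
have -> : (x - y) p - (x - y) q = (x p - x q) - (y p - y q).
  rewrite -[(x - y) p]/(x p - y p) -[(x - y) q]/(x q - y q).
  by rewrite !opprB [y q - x q]addrC addrACA [- y p + _]addrC.
by apply: (subgroupB (lideal_subgroup uhom_subgroup _ _)); [exact: h1|exact: h2].
Qed.

Lemma cauchyM k l x y : cauchy k x -> cauchy l y -> cauchy (k + l) (x * y).
Proof.
move=> [hx cx] [hy cy]; split=> [n|N]; first exact: uhom_M.
have [n1 h1] := cx (N + l); have [n2 h2] := cy N.
exists (maxn n1 n2) => p q; rewrite !geq_max => /andP[p1 p2] /andP[q1 q2].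
have -> : (x * y) p - (x * y) q = x p * (y p - y q) + (x p - x q) * y q.
  by rewrite mulrBr mulrBl addrA subrK.
apply: (subgroupD (lideal_subgroup uhom_subgroup _ _)).
  exact: (lideal_mull (@uhom_M C V) (hx p) (h2 _ _ p2 q2)).
have := lideal_mulr (@uhom_M C V) (hy q) (h1 _ _ p1 q1).
by rewrite opprD subrK.
Qed.

Definition ucst (u : U) : nat -> U := fun=> u.

Lemma cauchy_cst k u : uhom k u -> cauchy k (ucst u).
Proof.
move=> hu; split=> // N; exists 0%N => p q _ _; rewrite subrr.
exact: subgroup0 (lideal_subgroup uhom_subgroup _ _).
Qed.

Lemma cseq_subgroup : subgroup cseq.
Proof.
split; first exact: cseq_hom (subgroup0 (cauchy_subgroup 0)).
move=> x y hx hy; apply: cseq_D => //; elim: hy => {x hx y} [k x hx|x y _ IHx _ IHy].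
  exact: cseq_hom (subgroupN (cauchy_subgroup k) hx).
by rewrite opprD; exact: cseq_D.
Qed.

Lemma cseq1 : cseq 1.
Proof. exact: cseq_hom (cauchy_cst uhom1). Qed.

Lemma cseqM x y : cseq x -> cseq y -> cseq (x * y).
Proof.
move=> hx hy; elim: hx => {x} [k x hx|x x' _ IHx _ IHx'].
  elim: hy => {y} [l y hy|y y' _ IHy _ IHy'].
    exact: cseq_hom (cauchyM hx hy).
  by rewrite mulrDr; exact: cseq_D.
by rewrite mulrDl; exact: cseq_D.
Qed.

(* the partial sums of the difference of the two sides of
   (a_(-1) b)_[n] = sum_{j<0} a_[j] b_[n-j-1] + sum_{j>=0} b_[n-j-1] a_[j];
   the negative index of the first sum is written -1-j with j >= 0 *)
Definition normal_order (a b : V) (n : int) : nat -> U := fun M =>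
  ugen (md a (-1) b) n
  - (\sum_(j < M) ugen a (-1 - j%:Z) * ugen b (n + j%:Z)
     + \sum_(j < M) ugen b (n - j%:Z - 1) * ugen a j%:Z).

(* The two-sided ideal generated by the null sequences, 1_[-1] = 1 and the
   relations above. It is not closed a priori, but this does not affect the
   algebras and modules defined from [UU], which are quotients by open
   subgroups in each degree. *)
Inductive relid : set (nat -> U) :=
| relid_null k x :
    cauchy k x -> (forall N : int, eventually_in (- N) k x) -> relid x
| relid_vac : relid (ucst (ugen vac (-1) - 1))
| relid_normal a b n : relid (normal_order a b n)
| relid_B x y : relid x -> relid y -> relid (x - y)
| relid_Ml x y : cseq x -> relid y -> relid (x * y)
| relid_Mr x y : relid x -> cseq y -> relid (x * y).

Lemma relid_subgroup : subgroup relid.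
Proof.
split; last exact: relid_B.
apply: (@relid_null 0); first exact: subgroup0 (cauchy_subgroup 0).
move=> N; exists 0%N => n _; exact: subgroup0 (lideal_subgroup uhom_subgroup _ _).
Qed.

(* The universal enveloping algebra of V. The completion is taken degree by
   degree, so its elements are classes of finite sums of homogeneous Cauchy
   sequences. *)
Definition UU_setoid : rsetoid :=
  rsubquot_setoid cseq_subgroup relid_subgroup cseq1 cseqM relid_Ml relid_Mr.
Definition UU : Type := rquot UU_setoid.
HB.instance Definition _ := GRing.PzRing.on UU.

Definition ulim (x : nat -> U) (cx : cseq x) : UU :=
  @rpi UU_setoid (exist _ x cx).

(* the class of a homogeneous Cauchy sequence *)
Definition hlim k (x : nat -> U) (cx : cauchy k x) : UU := ulim (cseq_hom cx).

Lemma ulimE x y (cx : cseq x) (cy : cseq y) :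
  ulim cx = ulim cy <-> relid (x - y).
Proof. exact: zpiP. Qed.
Lemma ulim_irr x y (cx : cseq x) (cy : cseq y) : x = y -> ulim cx = ulim cy.
Proof. by move=> xy; apply/ulimE; rewrite xy subrr; exact: subgroup0 relid_subgroup. Qed.
Lemma ulimB x y (cx : cseq x) (cy : cseq y) :
  ulim cx - ulim cy = ulim (subgroupB cseq_subgroup cx cy).
Proof.
rewrite -[- ulim cy]zpiN -[RHS]/(ulim _).
by apply: (etrans (esym (zpiD _ _))); apply: ulim_irr.
Qed.
Lemma ulimM x y (cx : cseq x) (cy : cseq y) :
  ulim cx * ulim cy = ulim (cseqM cx cy).
Proof.
apply: (etrans (esym (@rpiM UU_setoid (exist _ x cx) (exist _ y cy)))).
exact: ulim_irr.
Qed.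

Definition Uhom (k : int) : set UU := [set x |
  exists (s : nat -> U) (cs : cauchy k s), x = hlim cs].

(* neighbourhoods of [0] in the component of degree [k] *)
Definition nbhd (m k : int) : set UU := [set x |
  exists (s : nat -> U) (cs : cauchy k s), eventually_in m k s /\ x = hlim cs].

Definition closure (k : int) (A : set UU) : set UU := [set x |
  Uhom k x /\ forall N : int, exists2 y, A y & nbhd (- N) k (x - y)].

Lemma Uhom_subgroup k : subgroup (Uhom k).
Proof.
split.
  exists 0, (subgroup0 (cauchy_subgroup k)).
  by apply: (etrans (esym (zpi0 _))); exact: ulim_irr.
move=> _ _ [s [cs ->]] [t [ct ->]].
exists (s - t), (subgroupB (cauchy_subgroup k) cs ct).
by rewrite ulimB; exact: ulim_irr.
Qed.

Lemma Uhom1 : Uhom 0 1.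
Proof.
exists 1, (cauchy_cst uhom1).
by apply: (etrans (esym (rpi1 _))); exact: ulim_irr.
Qed.

Lemma UhomM k l x y : Uhom k x -> Uhom l y -> Uhom (k + l) (x * y).
Proof.
move=> [s [cs ->]] [t [ct ->]]; exists (s * t), (cauchyM cs ct).
by rewrite ulimM; exact: ulim_irr.
Qed.

Lemma eventually_subgroup m k : subgroup (eventually_in m k).
Proof.
split; first by exists 0%N => n _; exact: subgroup0 (lideal_subgroup uhom_subgroup _ _).
move=> x y [n1 h1] [n2 h2]; exists (maxn n1 n2) => n.
rewrite geq_max => /andP[/h1 hx /h2 hy].
exact: (subgroupB (lideal_subgroup uhom_subgroup _ _)).
Qed.

Lemma nbhd_subgroup m k : subgroup (nbhd m k).
Proof.
split.
  exists 0, (subgroup0 (cauchy_subgroup k)).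
  split; first exact: subgroup0 (eventually_subgroup _ _).
  by apply: (etrans (esym (zpi0 _))); exact: ulim_irr.
move=> _ _ [s [cs [es ->]]] [t [ct [et ->]]].
exists (s - t), (subgroupB (cauchy_subgroup k) cs ct).
split; first exact: (subgroupB (eventually_subgroup _ _)).
by rewrite ulimB; exact: ulim_irr.
Qed.

Lemma nbhdS m m' k x : (m <= m')%R -> nbhd m k x -> nbhd m' k x.
Proof.
move=> mm' [s [cs [[n0 h] ->]]]; exists s, cs; split=> //.
by exists n0 => n /h; exact: lidealS.
Qed.

Lemma nbhd_mull m k p u x : Uhom p u -> nbhd m k x -> nbhd m (p + k) (u * x).
Proof.
move=> [s [cs ->]] [t [ct [[n0 h] ->]]]; exists (s * t), (cauchyM cs ct).
split; last by rewrite ulimM; exact: ulim_irr.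
by exists n0 => n /h; apply: (lideal_mull (@uhom_M C V)); case: cs.
Qed.

Lemma nbhd_mulr m k q v x :
  Uhom q v -> nbhd m k x -> nbhd (m + q) (k + q) (x * v).
Proof.
move=> [s [cs ->]] [t [ct [[n0 h] ->]]]; exists (t * s), (cauchyM ct cs).
split; last by rewrite ulimM; exact: ulim_irr.
by exists n0 => n /h; apply: (lideal_mulr (@uhom_M C V)); case: cs.
Qed.

(* [Lid m k] and [Rid m k] are the degree-[k] parts of U U_{<= -m} and
   U_{>= m} U. In the topological algebra U these products are understood as
   closed ideals, i.e. convergent infinite sums are allowed: only then is
   U / U U_{<= -1} killed degreewise by the tails of the infinite sums in
   [normal_order], hence a V-module, and U_0 / (U U_{<= -d-1})_0 the level-d
   Zhu algebra, which is a quotient of the uncompleted algebra. *)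
Definition Lid (m k : int) : set UU := closure k (lideal Uhom (- m) k).
Definition Rid (m k : int) : set UU := closure k (rideal Uhom m k).

Lemma closure_subgroup k A : subgroup A -> subgroup (closure k A).
Proof.
move=> sA; split.
  split=> [|N]; first exact: subgroup0 (Uhom_subgroup k).
  exists 0; first exact: subgroup0 sA.
  by rewrite subrr; exact: subgroup0 (nbhd_subgroup _ _).
move=> x y [hx cx] [hy cy]; split=> [|N].
  exact: (subgroupB (Uhom_subgroup k)).
have [x' Ax' nx] := cx N; have [y' Ay' ny] := cy N.
exists (x' - y'); first exact: (subgroupB sA).
have -> : x - y - (x' - y') = (x - x') - (y - y').
  by rewrite !opprB [y' - x']addrC addrACA [- y + _]addrC.
exact: (subgroupB (nbhd_subgroup _ _)).
Qed.

Lemma Lid_subgroup m k : subgroup (Lid m k).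
Proof. exact/closure_subgroup/lideal_subgroup/Uhom_subgroup. Qed.

Lemma RidE m k : Rid m k = Lid (m - k) k.
Proof. by rewrite /Rid ridealE /Lid opprB. Qed.

Lemma Rid_subgroup m k : subgroup (Rid m k).
Proof. by rewrite RidE; exact: Lid_subgroup. Qed.

Lemma Lid_mull m k p u x : Uhom p u -> Lid m k x -> Lid m (p + k) (u * x).
Proof.
move=> hu [hx cx]; split=> [|N]; first exact: UhomM.
have [y Ay ny] := cx N; exists (u * y).
  exact: (lideal_mull UhomM hu Ay).
by rewrite -mulrBr; exact: nbhd_mull.
Qed.

Lemma Lid_mulr m k q v x : Uhom q v -> Lid m k x -> Lid (m - q) (k + q) (x * v).
Proof.
move=> hv [hx cx]; split=> [|N]; first exact: UhomM.
have [y Ay ny] := cx (N + q); exists (y * v).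
  by have := lideal_mulr UhomM hv Ay; rewrite opprB addrC.
by rewrite -mulrBl; have := nbhd_mulr hv ny; rewrite opprD subrK.
Qed.

Lemma Lid_mull_eq m k p k' u x : p + k = k' ->
  Uhom p u -> Lid m k x -> Lid m k' (u * x).
Proof. by move=> <-; exact: Lid_mull. Qed.
Lemma Lid_mulr_eq m k q m' k' v x : m - q = m' -> k + q = k' ->
  Uhom q v -> Lid m k x -> Lid m' k' (x * v).
Proof. by move=> <- <-; exact: Lid_mulr. Qed.

Lemma Lid0_mull m x y : Uhom 0 x -> Lid m 0 y -> Lid m 0 (x * y).
Proof. exact: (@Lid_mull m 0 0). Qed.
Lemma Lid0_mulr m x y : Lid m 0 x -> Uhom 0 y -> Lid m 0 (x * y).
Proof. by move=> hx hy; have := Lid_mulr hy hx; rewrite subr0. Qed.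
Lemma Uhom0M x y : Uhom 0 x -> Uhom 0 y -> Uhom 0 (x * y).
Proof. exact: (@UhomM 0 0). Qed.

Definition U0 : Type := {x : UU | Uhom 0 x}.

(* the level-[d] Zhu algebra U_0 / (U.U_{<= -d-1})_0; [zhu 0] is Zhu's
   algebra *)
Definition zhu_setoid (d : nat) : rsetoid :=
  rsubquot_setoid (Uhom_subgroup 0) (Lid_subgroup (d%:Z + 1) 0) Uhom1 Uhom0M
    (@Lid0_mull _) (@Lid0_mulr _).
Definition zhu (d : nat) : Type := rquot (zhu_setoid d).
HB.instance Definition _ d := GRing.PzRing.on (zhu d).

Definition zhu_cl (d : nat) (x : U0) : zhu d := @rpi (zhu_setoid d) x.
Local Notation A := (zhu 0).
Local Notation acl := (zhu_cl 0).

Lemma zhu_clE d x y : zhu_cl d x = zhu_cl d y <-> Lid (d%:Z + 1) 0 (sval x - sval y).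
Proof. exact: zpiP. Qed.

(* (U / U.U_{<= -1})_j *)
Definition Lq (j : nat) : Type :=
  zquot (subquot_setoid (Uhom_subgroup j%:Z) (Lid_subgroup 1 j%:Z)).
HB.instance Definition _ j := GRing.Zmodule.on (Lq j).
Definition lcl j (u : {x | Uhom j%:Z x}) : Lq j :=
  @zpi (subquot_setoid (Uhom_subgroup j%:Z) (Lid_subgroup 1 j%:Z)) u.
Definition lrepr j (p : Lq j) : {x | Uhom j%:Z x} := zrepr p.

(* (U / U_{>= 1}.U)_{-j} *)
Definition Rq (j : nat) : Type :=
  zquot (subquot_setoid (Uhom_subgroup (- j%:Z)) (Rid_subgroup 1 (- j%:Z))).
HB.instance Definition _ j := GRing.Zmodule.on (Rq j).
Definition rcl j (v : {x | Uhom (- j%:Z) x}) : Rq j :=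
  @zpi (subquot_setoid (Uhom_subgroup (- j%:Z)) (Rid_subgroup 1 (- j%:Z))) v.
Definition rrepr j (q : Rq j) : {x | Uhom (- j%:Z) x} := zrepr q.

Lemma lclE j x y : @lcl j x = lcl y <-> Lid 1 j%:Z (sval x - sval y).
Proof. exact: zpiP. Qed.
Lemma rclE j x y : @rcl j x = rcl y <-> Rid 1 (- j%:Z) (sval x - sval y).
Proof. exact: zpiP. Qed.
Lemma lqreprK j (p : Lq j) : lcl (lrepr p) = p. Proof. exact: zreprK. Qed.
Lemma rqreprK j (q : Rq j) : rcl (rrepr q) = q. Proof. exact: zreprK. Qed.

Definition umulr k (u : {x | Uhom k x}) (x : U0) : {x | Uhom k x} :=
  exist _ (sval u * sval x)
    (eq_ind _ (fun l => Uhom l _) (UhomM (svalP u) (svalP x)) _ (addr0 k)).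
Definition umull k (x : U0) (v : {x | Uhom k x}) : {x | Uhom k x} :=
  exist _ (sval x * sval v)
    (eq_ind _ (fun l => Uhom l _) (UhomM (svalP x) (svalP v)) _ (add0r k)).
Definition upair j (v : {x | Uhom (- j%:Z) x}) (u : {x | Uhom j%:Z x}) : U0 :=
  exist _ (sval v * sval u)
    (eq_ind _ (fun l => Uhom l _) (UhomM (svalP v) (svalP u)) _ (addNr j%:Z)).

Definition ractL j (p : Lq j) (x : U0) : Lq j := lcl (umulr (lrepr p) x).
Definition lactR j (x : U0) (q : Rq j) : Rq j := rcl (umull x (rrepr q)).

Lemma ractLE j u x : ractL (lcl u) x = lcl (umulr u x) :> Lq j.
Proof.
apply/lclE; rewrite /= -mulrBl.
apply: (Lid_mulr_eq (subr0 1) (addr0 _) (svalP x)).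
by apply/lclE; rewrite lqreprK.
Qed.
Lemma lactRE j x v : lactR x (rcl v) = rcl (umull x v) :> Rq j.
Proof.
apply/rclE; rewrite /= -mulrBr RidE.
apply: (Lid_mull_eq (add0r _) (svalP x)); rewrite -RidE.
by apply/rclE; rewrite rqreprK.
Qed.

Definition lactA (x : U0) (a : A) : A := acl x * a.
Definition ractA (a : A) (x : U0) : A := a * acl x.

(* the degree-[j] part of Phi^L(M), for [M] with action [la] of U_0 *)
Definition PhiL (M : zmodType) (la : U0 -> M -> M) (j : nat) : Type :=
  tensor (@ractL j) la.
HB.instance Definition _ M la j := GRing.Zmodule.on (@PhiL M la j).

(* the degree-[-j] part of Phi^R(N), for [N] with action [ra] of U_0 *)
Definition PhiR (N : zmodType) (ra : N -> U0 -> N) (j : nat) : Type :=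
  tensor ra (@lactR j).
HB.instance Definition _ N ra j := GRing.Zmodule.on (@PhiR N ra j).

Local Notation PhiLA := (PhiL lactA).
Local Notation PhiRA := (PhiR ractA).

(* (u (x) a) b = u (x) ab and b (a (x) v) = ba (x) v *)
Definition ractPhi j (t : PhiLA j) (b : A) : PhiLA j :=
  tlift (fun u a => pure (@ractL j) lactA u (a * b)) t.
Definition lactPhi j (b : A) (t : PhiRA j) : PhiRA j :=
  tlift (fun a v => pure ractA (@lactR j) (b * a) v) t.

Lemma ractPhi_balanced j b :
  balanced (@ractL j) lactA (fun u a => pure (@ractL j) lactA u (a * b)).
Proof.
split=> [u u' a|u a a'|u x a]; first exact: pureDl.
  by rewrite mulrDl; exact: pureDr.
by rewrite pure_bal /lactA mulrA.
Qed.
Lemma lactPhi_balanced j b :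
  balanced ractA (@lactR j) (fun a v => pure ractA (@lactR j) (b * a) v).
Proof.
split=> [a a' v|a v v'|a x v]; last by rewrite -pure_bal /ractA mulrA.
  by rewrite mulrDr; exact: pureDl.
exact: pureDr.
Qed.
Lemma ractPhiE j u a b : ractPhi (pure (@ractL j) lactA u a) b = pure _ _ u (a * b).
Proof. exact: tlift_pure (ractPhi_balanced j b) _ _. Qed.
Lemma lactPhiE j b a v : lactPhi b (pure ractA (@lactR j) a v) = pure _ _ (b * a) v.
Proof. exact: tlift_pure (lactPhi_balanced j b) _ _. Qed.
Lemma ractPhiDl j s t b : ractPhi (s + t : PhiLA j) b = ractPhi s b + ractPhi t b.
Proof. exact: tliftD (ractPhi_balanced j b) _ _. Qed.
Lemma lactPhiDr j b s t : lactPhi b (s + t : PhiRA j) = lactPhi b s + lactPhi b t.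
Proof. exact: tliftD (lactPhi_balanced j b) _ _. Qed.

Lemma ractPhiDr j (t : PhiLA j) b b' : ractPhi t (b + b') = ractPhi t b + ractPhi t b'.
Proof.
apply: (@tensor_ext _ _ _ _ _ _ (fun t => ractPhi t (b + b'))
  (fun t => ractPhi t b + ractPhi t b')) => [s u|s u|u a].
- exact: ractPhiDl.
- by rewrite !ractPhiDl addrACA.
- by rewrite !ractPhiE mulrDr; exact: pureDr.
Qed.
Lemma lactPhiDl j b b' (t : PhiRA j) : lactPhi (b + b') t = lactPhi b t + lactPhi b' t.
Proof.
apply: (@tensor_ext _ _ _ _ _ _ (lactPhi (b + b'))
  (fun t => lactPhi b t + lactPhi b' t)) => [s u|s u|a v].
- exact: lactPhiDr.
- by rewrite !lactPhiDr addrACA.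
- by rewrite !lactPhiE mulrDl; exact: pureDl.
Qed.
Lemma lactPhiM j b b' (t : PhiRA j) : lactPhi (b * b') t = lactPhi b (lactPhi b' t).
Proof.
apply: (@tensor_ext _ _ _ _ _ _ (lactPhi (b * b'))
  (fun t => lactPhi b (lactPhi b' t))) => [s u|s u|a v].
- exact: lactPhiDr.
- by rewrite !lactPhiDr.
- by rewrite !lactPhiE mulrA.
Qed.
Lemma ractPhiM j (t : PhiLA j) b b' : ractPhi t (b * b') = ractPhi (ractPhi t b) b'.
Proof.
apply: (@tensor_ext _ _ _ _ _ _ (fun t => ractPhi t (b * b'))
  (fun t => ractPhi (ractPhi t b) b')) => [s u|s u|u a].
- exact: ractPhiDl.
- by rewrite !ractPhiDl.
- by rewrite !ractPhiE mulrA.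
Qed.

(* [frakA i j] is the component of bidegree (i, -j) *)
Definition frakA (i j : nat) : Type := tensor (@ractPhi i) (@lactPhi j).
HB.instance Definition _ i j := GRing.Zmodule.on (frakA i j).

(* [vu] in A, for v of degree -j and u of degree j *)
Definition brk j (v : Rq j) (u : Lq j) : A := acl (upair (rrepr v) (lrepr u)).

Lemma brkE j v u : brk (rcl v) (lcl u) = acl (@upair j v u).
Proof.
set v' := rrepr (rcl v); set u' := lrepr (lcl u).
apply/zhu_clE; rewrite /= -/u' -/v' add0r.
have -> : sval v' * sval u' - sval v * sval u
        = sval v' * (sval u' - sval u) + (sval v' - sval v) * sval u.
  by rewrite mulrBr mulrBl addrA subrK.
apply: (subgroupD (Lid_subgroup _ _)).
  apply: (Lid_mull_eq (addNr _) (svalP v')).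
  by apply/lclE; rewrite lqreprK.
apply: (@Lid_mulr_eq (1 - - j%:Z) (- j%:Z) j%:Z) (svalP u) _.
- by rewrite opprK addrK.
- by rewrite addNr.
- by rewrite -RidE; apply/rclE; rewrite rqreprK.
Qed.

(* <b (x) v, u (x) a> = b [vu] a; components of non-opposite degrees pair
   to 0, so [star] is only needed from [frakA i j] and [frakA j l] to
   [frakA i l]; see [pairingE] and [starE] *)
Definition pairing j (beta : PhiRA j) (alpha : PhiLA j) : A :=
  tlift (fun b v => tlift (fun u a => b * brk v u * a) alpha) beta.

(* (x (x) beta) * (alpha (x) y) = x (x) <beta, alpha> y *)
Definition star i j l (s : frakA i j) (t : frakA j l) : frakA i l :=
  tlift (fun x beta => tlift (fun alpha y =>
    pure (@ractPhi i) (@lactPhi l) x (lactPhi (pairing beta alpha) y)) t) s.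

Lemma brkDl j (v v' : Rq j) u : brk (v + v') u = brk v u + brk v' u.
Proof.
rewrite -(rqreprK v) -(rqreprK v') -(lqreprK u) -[rcl _ + rcl _]zpiD.
rewrite -/(rcl _) !brkE -[RHS]rpiD; apply/zpiP => /=.
by rewrite mulrDl subrr; exact: subgroup0 (Lid_subgroup _ _).
Qed.
Lemma brkDr j (v : Rq j) u u' : brk v (u + u') = brk v u + brk v u'.
Proof.
rewrite -(rqreprK v) -(lqreprK u) -(lqreprK u') -[lcl _ + lcl _]zpiD.
rewrite -/(lcl _) !brkE -[RHS]rpiD; apply/zpiP => /=.
by rewrite mulrDr subrr; exact: subgroup0 (Lid_subgroup _ _).
Qed.
Lemma brk_ract j (v : Rq j) u x : brk v (ractL u x) = brk v u * acl x.
Proof.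
rewrite -(rqreprK v) -(lqreprK u) ractLE !brkE -[RHS]rpiM; apply/zpiP => /=.
by rewrite mulrA subrr; exact: subgroup0 (Lid_subgroup _ _).
Qed.
Lemma brk_lact j x (v : Rq j) u : brk (lactR x v) u = acl x * brk v u.
Proof.
rewrite -(rqreprK v) -(lqreprK u) lactRE !brkE -[RHS]rpiM; apply/zpiP => /=.
by rewrite mulrA subrr; exact: subgroup0 (Lid_subgroup _ _).
Qed.

Lemma pairing_balancedr j b v :
  balanced (@ractL j) lactA (fun u a => b * brk v u * a).
Proof.
split=> [u u' a|u a a'|u x a]; first by rewrite brkDr mulrDr mulrDl.
  by rewrite mulrDr.
by rewrite brk_ract /lactA !mulrA.
Qed.
Lemma pairing_purer j b v (alpha : PhiLA j) (c : A) :
  tlift (fun u a => c * b * brk v u * a) alpha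
  = c * tlift (fun u a => b * brk v u * a) alpha.
Proof.
apply: (@tensor_ext _ _ _ _ _ _ (tlift (fun u a => c * b * brk v u * a))
  (fun t => c * tlift (fun u a => b * brk v u * a) t)) => [s t|s t|u a].
- exact: tliftD (pairing_balancedr _ _) _ _.
- by rewrite (tliftD (pairing_balancedr _ _)) mulrDr.
- by rewrite !(tlift_pure (pairing_balancedr _ _)) !mulrA.
Qed.
Lemma pairing_balancedl j (alpha : PhiLA j) :
  balanced ractA (@lactR j)
    (fun b v => tlift (fun u a => b * brk v u * a) alpha).
Proof.
have D := fun b v => tliftD (@pairing_balancedr j b v).
have P := fun b v => tlift_pure (@pairing_balancedr j b v).
split=> [b b' v|b v v'|b x v]; move: alpha; apply: tensor_ext => [s t|s t|u a];
  rewrite ?D ?P //.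
- by rewrite addrACA.
- by rewrite !mulrDl.
- by rewrite addrACA.
- by rewrite brkDl mulrDr mulrDl.
- by rewrite brk_lact /ractA !mulrA.
Qed.

Lemma pairingE j b v u a :
  pairing (pure ractA (@lactR j) b v) (pure (@ractL j) lactA u a)
  = b * brk v u * a.
Proof.
rewrite /pairing (tlift_pure (pairing_balancedl _)).
exact: tlift_pure (pairing_balancedr _ _) _ _.
Qed.
Lemma pairingDl j (s t : PhiRA j) (al : PhiLA j) :
  pairing (s + t) al = pairing s al + pairing t al.
Proof. exact: tliftD (pairing_balancedl al) _ _. Qed.
Lemma pairingDr j (be : PhiRA j) (s t : PhiLA j) :
  pairing be (s + t) = pairing be s + pairing be t.
Proof.
move: be; apply: tensor_ext => [p q|p q|b v].
- exact: pairingDl.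
- by rewrite !pairingDl addrACA.
rewrite /pairing !(tlift_pure (pairing_balancedl _)).
exact: tliftD (pairing_balancedr _ _) _ _.
Qed.
Lemma pairing_ract j (be : PhiRA j) (al : PhiLA j) c :
  pairing be (ractPhi al c) = pairing be al * c.
Proof.
move: be; apply: tensor_ext => [p q|p q|b v].
- exact: pairingDl.
- by rewrite pairingDl mulrDl.
move: al; apply: tensor_ext => [p q|p q|u a].
- by rewrite ractPhiDl pairingDr.
- by rewrite pairingDr mulrDl.
- by rewrite ractPhiE !pairingE mulrA.
Qed.
Lemma pairing_lact j c (be : PhiRA j) (al : PhiLA j) :
  pairing (lactPhi c be) al = c * pairing be al.
Proof.
move: be; apply: tensor_ext => [p q|p q|b v].
- by rewrite lactPhiDr pairingDl.
- by rewrite pairingDl mulrDr.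
move: al; apply: tensor_ext => [p q|p q|u a].
- exact: pairingDr.
- by rewrite pairingDr mulrDr.
- by rewrite lactPhiE !pairingE !mulrA.
Qed.

Lemma star_balancedr i j l (x : PhiLA i) (be : PhiRA j) :
  balanced (@ractPhi j) (@lactPhi l) (fun al y =>
    pure (@ractPhi i) (@lactPhi l) x (lactPhi (pairing be al) y)).
Proof.
split=> [al al' y|al y y'|al c y].
- by rewrite pairingDr lactPhiDl; exact: pureDr.
- by rewrite lactPhiDr; exact: pureDr.
- by rewrite pairing_ract lactPhiM.
Qed.
Lemma star_balancedl i j l (t : frakA j l) :
  balanced (@ractPhi i) (@lactPhi j) (fun x be => tlift (fun al y =>
    pure (@ractPhi i) (@lactPhi l) x (lactPhi (pairing be al) y)) t).
Proof.
have D := fun x be => tliftD (@star_balancedr i j l x be).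
have P := fun x be => tlift_pure (@star_balancedr i j l x be).
split=> [x x' be|x be be'|x c be]; move: t; apply: tensor_ext => [s t|s t|al y];
  rewrite ?D ?P //.
- by rewrite addrACA.
- exact: pureDl.
- by rewrite addrACA.
- by rewrite pairingDl lactPhiDl; exact: pureDr.
- by rewrite pairing_lact lactPhiM; exact: pure_bal.
Qed.

Lemma starE i j l x be al y :
  star (pure (@ractPhi i) (@lactPhi j) x be) (pure (@ractPhi j) (@lactPhi l) al y)
  = pure (@ractPhi i) (@lactPhi l) x (lactPhi (pairing be al) y).
Proof.
rewrite /star (tlift_pure (@star_balancedl _ _ _ _)).
exact: tlift_pure (@star_balancedr _ _ _ _ _) _ _.
Qed.
Lemma starDl i j l (s s' : frakA i j) (t : frakA j l) :
  star (s + s') t = star s t + star s' t.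
Proof. exact: tliftD (@star_balancedl _ _ _ t) _ _. Qed.
Lemma starDr i j l (s : frakA i j) (t t' : frakA j l) :
  star s (t + t') = star s t + star s t'.
Proof.
move: s; apply: tensor_ext => [p q|p q|x be].
- exact: starDl.
- by rewrite !starDl addrACA.
rewrite /star !(tlift_pure (@star_balancedl _ _ _ _)).
exact: tliftD (@star_balancedr _ _ _ _ _) _ _.
Qed.

Definition strongly_unital (j : nat) : Prop :=
  exists e : frakA j j,
    (forall x : frakA 0 j, star x e = x) /\ (forall y : frakA j 0, star e y = y).

Definition non_exceptional (j : nat) : Prop := exists x : PhiLA j, x <> 0.

Fixpoint tact (t : term V) (v : V) : V :=
  match t with
  | tsc c => c *: v
  | tgen a n => md a n v
  | tadd x y => tact x v + tact y v
  | tmul x y => tact x (tact y v)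
  end.

Lemma mdDl (a a' : V) n b : md (a + a') n b = md a n b + md a' n b.
Proof. by have := md_linl n b 1 a a'; rewrite !scale1r. Qed.
Lemma mdDr (a : V) n b b' : md a n (b + b') = md a n b + md a n b'.
Proof. by have := md_linr a n 1 b b'; rewrite !scale1r. Qed.
Lemma md0r (a : V) n : md a n 0 = 0.
Proof. by apply: (addrI (md a n 0)); rewrite -mdDr !addr0. Qed.
Lemma md0l n (b : V) : md 0 n b = 0.
Proof. by apply: (addrI (md 0 n b)); rewrite -mdDl !addr0. Qed.
Lemma mdZr (a : V) n c b : md a n (c *: b) = c *: md a n b.
Proof. by have := md_linr a n c b 0; rewrite md0r !addr0. Qed.
Lemma mdZl c (a : V) n b : md (c *: a) n b = c *: md a n b.
Proof. by have := md_linl n b c a 0; rewrite md0l !addr0. Qed.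

Lemma tactD t v w : tact t (v + w) = tact t v + tact t w.
Proof.
elim: t v w => [c|a n|x IHx y IHy|x IHx y IHy] v w /=.
- exact: scalerDr.
- exact: mdDr.
- by rewrite IHx IHy addrACA.
- by rewrite IHy IHx.
Qed.
Lemma tactZ t c v : tact t (c *: v) = c *: tact t v.
Proof.
elim: t v => [c'|a n|x IHx y IHy|x IHx y IHy] v /=.
- by rewrite !scalerA mulrC.
- exact: mdZr.
- by rewrite IHx IHy scalerDr.
- by rewrite IHy IHx.
Qed.

Lemma tact_sum (I : Type) (r : seq I) (F : I -> term V) v :
  tact (tsum [seq F i | i <- r]) v = \sum_(i <- r) tact (F i) v.
Proof.
by elim: r => [|i r IH] /=; rewrite ?big_nil ?scale0r // big_cons IH.
Qed.

Lemma zbinom0 m : zbinom C m 0 = 1.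
Proof. by rewrite /zbinom big_ord0 fact0 divr1. Qed.
Lemma zbinom_0S j : zbinom C 0 j.+1 = 0.
Proof. by rewrite /zbinom big_ord_recl subrr !mul0r. Qed.
Lemma zbinomN1 j : zbinom C (-1) j = (-1) ^+ j.
Proof.
rewrite /zbinom; suff -> : \prod_(i < j) ((-1)%:~R - i%:R) = (-1) ^+ j * j`!%:R :> C.
  by rewrite mulfK // pnatr_eq0 -lt0n fact_gt0.
elim: j => [|j IH]; first by rewrite big_ord0 mul1r.
rewrite big_ord_recr /= IH exprS factS natrM rmorphN1 -opprD -(natrD _ 1) add1n.
by ring.
Qed.
Lemma md_trunc_from (a c : V) (m : int) : exists N : nat,
  forall j : nat, (N <= j)%N -> md a (m + j%:Z) c = 0.
Proof.
have [N h] := md_trunc a c; exists (N + absz m)%N => j hj.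
have -> : m + j%:Z = (absz (m + j%:Z))%:Z by lia.
by apply: h; lia.
Qed.

Lemma md_bracket (a b c : V) (m n : int) (N : nat) :
  (forall j : nat, (N <= j)%N -> md a j%:Z b = 0) ->
  md a m (md b n c) = md b n (md a m c)
    + \sum_(j < N) zbinom C m j *: md (md a j%:Z b) (m + n - j%:Z) c.
Proof.
move=> hN; have [N1 h1] := md_trunc_from a c m; have [N2 h2] := md_trunc_from b c n.
pose M := (maxn N (maxn N1 N2)).+1.
have hM (j : nat) : (M <= j)%N -> (N <= j)%N /\ (N1 <= j)%N /\ (N2 <= j)%N.
  by rewrite /M; lia.
have e : forall j : nat, (M <= j)%N -> md a (0 + j%:Z) b = 0.
  by move=> j hj; rewrite add0r; apply: hN; case: (hM j hj).
have B := @borcherds C V a b c m 0 n M e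
  (fun j hj => h1 j (proj1 (proj2 (hM j hj))))
  (fun j hj => h2 j (proj2 (proj2 (hM j hj)))).
move: B; rewrite [RHS]big_ord_recl [X in _ = _ + X]big1 ?addr0; last first.
  by move=> i _; rewrite /= zbinom_0S mulr0 scale0r.
rewrite expr0 mul1r zbinom0 scale1r expr0z scale1r add0r => B.
rewrite addrC -[LHS](subrK (md b n (md a m c))) -B; congr (_ + _).
pose F (j : nat) := zbinom C m j *: md (md a j%:Z b) (m + n - j%:Z) c.
have hNM : (N <= M)%N by rewrite /M; lia.
rewrite [RHS](@big_ord_widen _ _ _ N M F hNM).
rewrite [LHS](bigID (fun i : 'I_M => (i < N)%N)) /= [X in _ + X]big1 ?addr0.
  by apply: eq_bigr => i _; rewrite add0r.
by move=> i; rewrite -leqNgt => hi; rewrite add0r hN // md0l scaler0.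
Qed.

Lemma md_normal (a b c : V) (n : int) : exists N : nat, forall M, (N <= M)%N ->
  md (md a (-1) b) n c =
  \sum_(j < M) md a (-1 - j%:Z) (md b (n + j%:Z) c)
  + \sum_(j < M) md b (n - j%:Z - 1) (md a j%:Z c).
Proof.
have [N0 h0] := md_trunc_from a b (-1).
have [N1 h1] := md_trunc_from a c 0; have [N2 h2] := md_trunc_from b c n.
exists (maxn N0 (maxn N1 N2)).+1 => M hM.
have hj (j : nat) : (M <= j)%N -> (N0 <= j)%N /\ (N1 <= j)%N /\ (N2 <= j)%N by lia.
have B := @borcherds C V a b c 0 (-1) n M (fun j h => h0 j (proj1 (hj j h)))
  (fun j h => h1 j (proj1 (proj2 (hj j h))))
  (fun j h => h2 j (proj2 (proj2 (hj j h)))).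
clear hj.
move: B; case: M hM => [//|M] hM.
rewrite [LHS]big_ord_recl /= [X in _ + X]big1 ?addr0; last first.
  by move=> i _; rewrite /= zbinom_0S scale0r.
rewrite zbinom0 scale1r [0 + n]add0r => ->.
rewrite -big_split /=; apply: eq_bigr => j _.
rewrite zbinomN1 -exprMn mulrNN mulr1 expr1n scale1r ?add0r.
rewrite -[(-1) ^ (-1)]/((-1)^-1) invrN1 scaleN1r opprK.
by congr (_ + md b _ _); lia.
Qed.

Lemma tact_eq x y : teq x y -> tact x =1 tact y.
Proof.
elim=> {x y} //=.
- by move=> x y _ h v; rewrite h.
- by move=> x y z _ h _ k v; rewrite h k.
- by move=> x x' y y' _ h _ k v; rewrite h k.
- by move=> x x' y y' _ h _ k v; rewrite k h.
- by move=> x y z v; rewrite addrA.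
- by move=> x y v; rewrite addrC.
- by move=> x v; rewrite scale0r add0r.
- by move=> x v; rewrite scaleN1r addNr scale0r.
- by move=> x v; rewrite scale1r.
- by move=> x y z v; rewrite tactD.
- by move=> c c' v; rewrite scalerDl.
- by move=> c c' v; rewrite scalerA.
- by move=> c x v; rewrite tactZ.
- by move=> a b n v; rewrite mdDl.
- by move=> c a n v; rewrite mdZl.
- by move=> a n v; rewrite Lm1_der scaleNr addNr scale0r.
move=> a b m n N hN v; rewrite (md_bracket _ _ _ hN) tact_sum; congr (_ + _).
by rewrite -(big_mkord xpredT
     (fun j => zbinom C m j *: md (md a j%:Z b) (m + n - j%:Z) v)) /index_iota subn0.
Qed.

Definition uact (x : U) (v : V) : V := tact (zrepr x) v.

Lemma uactE t v : uact (uterm t) v = tact t v.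
Proof. by apply: tact_eq; exact: (@zpi_repr (term_setoid V)). Qed.
Lemma utermK (x : U) : uterm (zrepr x) = x. Proof. exact: rreprK. Qed.
Lemma uactDl x y v : uact (x + y) v = uact x v + uact y v.
Proof.
rewrite -{1}(utermK x) -{1}(utermK y).
have <- : uterm (tadd (zrepr x) (zrepr y)) = uterm (zrepr x) + uterm (zrepr y).
  exact: (@rpiD (term_setoid V)).
by rewrite uactE.
Qed.
Lemma uactM x y v : uact (x * y) v = uact x (uact y v).
Proof.
rewrite -{1}(utermK x) -{1}(utermK y).
have <- : uterm (tmul (zrepr x) (zrepr y)) = uterm (zrepr x) * uterm (zrepr y).
  exact: (@rpiM (term_setoid V)).
by rewrite uactE.
Qed.
Lemma uact1 v : uact 1 v = v.
Proof. by rewrite -[1]/(uterm (tsc V 1)) uactE /= scale1r. Qed.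
Lemma uact0l v : uact 0 v = 0.
Proof. by rewrite -[0]/(uterm (tsc V 0)) uactE /= scale0r. Qed.
Lemma uactNl x v : uact (- x) v = - uact x v.
Proof. by apply: (addrI (uact x v)); rewrite -uactDl !subrr uact0l. Qed.
Lemma uactDr x v w : uact x (v + w) = uact x v + uact x w.
Proof. exact: tactD. Qed.
Lemma uact0r x : uact x 0 = 0.
Proof. by apply: (addrI (uact x 0)); rewrite -uactDr !addr0. Qed.
Lemma uact_suml n (f : 'I_n -> U) v : uact (\sum_i f i) v = \sum_i uact (f i) v.
Proof.
elim/big_ind2: _ => //; first exact: uact0l.
by move=> x1 x2 y1 y2 <- <-; exact: uactDl.
Qed.
Lemma uact_sumr n x (f : 'I_n -> V) : uact x (\sum_i f i) = \sum_i uact x (f i).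
Proof.
elim/big_ind2: _ => //; first exact: uact0r.
by move=> x1 x2 y1 y2 <- <-; exact: uactDr.
Qed.

Definition Vdeg (r : int) (v : V) : Prop := forall p : nat, p%:Z != r -> proj p v = 0.

Lemma Vdeg_inj n (x : piece V n) : Vdeg n%:Z (inj n x).
Proof. by move=> p hp; apply: proj_inj0; apply: contra hp => /eqP ->. Qed.
Lemma Vdeg0 r : Vdeg r 0. Proof. by move=> p _; rewrite linear0. Qed.
Lemma VdegD r v w : Vdeg r v -> Vdeg r w -> Vdeg r (v + w).
Proof. by move=> hv hw p hp; rewrite linearD hv // hw // addr0. Qed.
Lemma Vdeg_neg r v : (r < 0)%R -> Vdeg r v -> v = 0.
Proof.
move=> r0 hv; have [N ->] := sum_proj v; rewrite big1 // => i _.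
by rewrite hv ?linear0 //; apply/eqP; lia.
Qed.
Lemma VdegE (n : nat) v : Vdeg n%:Z v -> inj n (proj n v) = v.
Proof.
move=> hv; have [N] := sum_proj v.
have z (i : 'I_N) : i != n :> nat -> inj i (proj i v) = 0.
  by move=> hi; rewrite hv ?linear0 //; apply: contra hi => /eqP [->].
case: (ltnP n N) => hn e.
  rewrite {2}e (bigD1 (Ordinal hn)) //= big1 ?addr0 // => i hi.
have {}e : v = 0.
  by rewrite e big1 // => i _; apply: z; rewrite neq_ltn (leq_trans (ltn_ord i)).
by rewrite e !linear0.
Qed.

Lemma md_Vdeg p (x : piece V p) n r v :
  Vdeg r v -> Vdeg (p%:Z - n - 1 + r) (md (inj p x) n v).
Proof.
move=> hv; case: r hv => [q|q] hv; last first.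
  by rewrite (Vdeg_neg _ hv) // md0r; exact: Vdeg0.
by rewrite -(VdegE hv) => s hs; apply: md_deg; apply: contra hs => /eqP ->; lia.
Qed.

Lemma uact_Vdeg k x r v : uhom k x -> Vdeg r v -> Vdeg (k + r) (uact x v).
Proof.
move=> hx; elim: hx r v => {k x} [k|c|p x n|k x y _ IHx _ IHy|k l x y _ IHx _ IHy] r v hv.
- by rewrite uact0l; exact: Vdeg0.
- by rewrite uactE add0r => p hp; rewrite /= linearZ /= hv // scaler0.
- by rewrite uactE; exact: md_Vdeg.
- by rewrite uactDl; apply: VdegD; [exact: IHx|exact: IHy].
- by rewrite uactM -addrA; apply/IHx/IHy.
Qed.

Lemma lideal_kill_hom m k x r v :
  lideal uhom m k x -> Vdeg r v -> (m + r < 0)%R -> uact x v = 0.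
Proof.
move=> [n [l [u [w [h ->]]]]] hv mr; rewrite uact_suml big1 // => i _.
have [h1 _ h3] := h i; rewrite uactM (@Vdeg_neg (l i + r) (uact (w i) v)).
- exact: uact0r.
- by apply: le_lt_trans mr; rewrite lerD2r.
- exact: uact_Vdeg.
Qed.

Lemma lideal_kill v : exists K : int, forall m k x, (m <= K)%R ->
  lideal uhom m k x -> uact x v = 0.
Proof.
have [N ->] := sum_proj v; exists (- N%:Z) => m k x hm hx.
rewrite uact_sumr big1 // => i _.
by apply: (lideal_kill_hom hx (Vdeg_inj _)); have := ltn_ord i; lia.
Qed.

Definition stab (s : nat -> U) (v w : V) : Prop :=
  exists n0 : nat, forall n : nat, (n0 <= n)%N -> uact (s n) v = w.

Lemma stabD s t v w w' : stab s v w -> stab t v w' -> stab (s + t) v (w + w').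
Proof.
move=> [n h] [n' h']; exists (maxn n n') => p; rewrite geq_max => /andP[hp hp'].
by rewrite -[(s + t) p]/(s p + t p) uactDl h // h'.
Qed.
Lemma stabN s v w : stab s v w -> stab (- s) v (- w).
Proof. by move=> [n h]; exists n => p hp; rewrite -[(- s) p]/(- s p) uactNl h. Qed.
Lemma stabM s t v w w' : stab t v w -> stab s w w' -> stab (s * t) v w'.
Proof.
move=> [n h] [n' h']; exists (maxn n n') => p; rewrite geq_max => /andP[hp hp'].
by rewrite -[(s * t) p]/(s p * t p) uactM h // h'.
Qed.
Lemma stab_uniq s v w w' : stab s v w -> stab s v w' -> w = w'.
Proof.
move=> [n h] [n' h'].
by rewrite -(h (maxn n n')) ?leq_maxl // h' // leq_maxr.
Qed.

Lemma cseq_stab s v : cseq s -> exists w, stab s v w.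
Proof.
elim=> {s} [k s [_ cs]|s t _ [w hw] _ [w' hw']]; last by exists (w + w'); exact: stabD.
have [K hK] := lideal_kill v; have [n0 h] := cs (- K).
exists (uact (s n0) v); exists n0 => n hn.
apply: subr0_eq; rewrite -uactNl -uactDl; apply: (hK K k) => //.
by have := h n n0 hn (leqnn _); rewrite opprK.
Qed.

Lemma relid_stab s v : relid s -> stab s v 0.
Proof.
move=> hs; elim: hs v => {s} [k s _ hs||a b n|s t _ IHs _ IHt|s t hs _ IH|s t _ IH ht] v.
- have [K hK] := lideal_kill v; have [n0 h] := hs (- K).
  by exists n0 => n /h; rewrite opprK; exact: hK.
- by exists 0%N => n _; rewrite uactDl uactNl uact1 uactE /= md_vac eqxx subrr.
- have [N h] := md_normal a b v n; exists N => M hM.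
  rewrite /normal_order uactDl uactNl uactDl !uact_suml uactE /= (h M hM).
  apply/eqP; rewrite subr_eq0; apply/eqP; congr (_ + _); apply: eq_bigr => j _;
    by rewrite uactM !uactE.
- by rewrite -(subrr 0); apply: stabD => //; exact: stabN.
- apply: stabM (IH v) _; exists 0%N => n _; exact: uact0r.
- by have [w hw] := cseq_stab v ht; exact: stabM hw (IH w).
Qed.

(* a Cauchy sequence acts on each vector by its eventually constant value *)
Definition Uact (x : UU) (v : V) : V :=
  xget 0 [set w | stab (sval (zrepr x)) v w].

Lemma UactE s (cs : cseq s) v w : stab s v w -> Uact (ulim cs) v = w.
Proof.
move=> h; rewrite /Uact; set s' := sval _.
have hs' : relid (s' - s) by exact: (@zpi_repr UU_setoid (exist _ s cs)).
have st : stab s' v w.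
  by rewrite -(subrK s s') -(add0r w); apply: stabD h; exact: relid_stab.
have st' := xgetI (P := [set w | stab s' v w]) 0 st.
exact: stab_uniq st' st.
Qed.

Lemma ulim_surj (x : UU) : exists s (cs : cseq s), x = ulim cs.
Proof. by rewrite -(rreprK x); case: (zrepr x) => s cs; exists s, cs. Qed.

Lemma UactM x y v : Uact (x * y) v = Uact x (Uact y v).
Proof.
have [s [cs ->]] := ulim_surj x; have [t [ct ->]] := ulim_surj y.
have [w hw] := cseq_stab v ct; have [w' hw'] := cseq_stab w cs.
by rewrite ulimM (UactE _ hw) (UactE _ hw'); apply/UactE/stabM/hw'.
Qed.
Lemma UactBl x y v : Uact (x - y) v = Uact x v - Uact y v.
Proof.
have [s [cs ->]] := ulim_surj x; have [t [ct ->]] := ulim_surj y.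
have [w hw] := cseq_stab v cs; have [w' hw'] := cseq_stab v ct.
rewrite ulimB (UactE _ hw) (UactE _ hw').
by apply/UactE; apply: stabD => //; exact: stabN.
Qed.
Lemma UactDr x v v' : Uact x (v + v') = Uact x v + Uact x v'.
Proof.
have [s [cs ->]] := ulim_surj x.
have [w hw] := cseq_stab v cs; have [w' hw'] := cseq_stab v' cs.
rewrite (UactE _ hw) (UactE _ hw'); apply/UactE.
case: hw hw' => [n h] [n' h']; exists (maxn n n') => p.
by rewrite geq_max => /andP[hp hp']; rewrite uactDr h // h'.
Qed.
Lemma Uact_cst u (cu : cseq (ucst u)) v : Uact (ulim cu) v = uact u v.
Proof. by apply: UactE; exists 0%N. Qed.

Lemma Uact_Vdeg k x r v : Uhom k x -> Vdeg r v -> Vdeg (k + r) (Uact x v).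
Proof.
move=> [s [cs ->]] hv; have [w hw] := cseq_stab v (cseq_hom cs).
rewrite (UactE _ hw); case: hw cs => n /(_ n (leqnn n)) <- [hs _].
exact: uact_Vdeg.
Qed.

Lemma Uact0l v : Uact 0 v = 0.
Proof. by rewrite -(subrr 0) UactBl subrr. Qed.
Lemma UactDl x y v : Uact (x + y) v = Uact x v + Uact y v.
Proof.
have N : Uact (- y) v = - Uact y v by rewrite -sub0r UactBl Uact0l sub0r.
by rewrite -{1}(opprK y) UactBl N opprK.
Qed.
Lemma Uact0r x : Uact x 0 = 0.
Proof. by apply: (addrI (Uact x 0)); rewrite -UactDr !addr0. Qed.

Lemma nbhd_kill m k x r v :
  nbhd m k x -> Vdeg r v -> (m + r < 0)%R -> Uact x v = 0.
Proof.
move=> [s [cs [[n0 h] ->]]] hv mr; apply: UactE; exists n0 => n /h hn.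
exact: lideal_kill_hom hn hv mr.
Qed.

Lemma Lid_kill m k x r v : Lid m k x -> Vdeg r v -> (r < m)%R -> Uact x v = 0.
Proof.
move=> [_ cx] hv rm; have [y [n [l [u [w [h ->]]]]]] := cx m.
move=> /nbhd_kill /(_ hv) e; have {}e := e ltac:(lia).
apply/eqP; rewrite -subr_eq0; apply/eqP; rewrite -[RHS]e UactBl; congr (_ - _).
elim/big_ind: _ => [|a b ha hb|i _]; first by rewrite Uact0l.
  by rewrite UactDl -ha -hb addr0.
have [h1 _ h3] := h i; rewrite UactM (@Vdeg_neg (l i + r) (Uact (w i) v)).
- by rewrite Uact0r.
- lia.
- exact: Uact_Vdeg.
Qed.

(* V_0 as a module over U_0 *)
Definition lactV0 (x : U0) (y : piece V 0) : piece V 0 :=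
  proj 0%N (Uact (sval x) (inj 0%N y)).

(* the degree-[j] part of the natural map Phi^L(V_0) -> V, u (x) y |-> u y;
   see [natmapE] *)
Definition natmap j (t : PhiL lactV0 j) : V :=
  tlift (fun u y => Uact (sval (lrepr u)) (inj 0%N y)) t.

Lemma Uact_lrepr j (u : {x | Uhom j%:Z x}) (y : piece V 0) :
  Uact (sval (lrepr (lcl u))) (inj 0%N y) = Uact (sval u) (inj 0%N y).
Proof.
apply: subr0_eq; rewrite -UactBl; apply: (@Lid_kill 1 j%:Z _ 0) => //.
- by apply/lclE; rewrite lqreprK.
- exact: Vdeg_inj.
Qed.

Lemma natmap_balanced j : balanced (@ractL j) lactV0
  (fun u y => Uact (sval (lrepr u)) (inj 0%N y)).
Proof.
split=> [u u' y|u y y'|u x y].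
- rewrite -(lqreprK u) -(lqreprK u') -[lcl _ + lcl _]zpiD -/(lcl _).
  by rewrite !Uact_lrepr UactDl.
- by rewrite linearD UactDr.
- rewrite Uact_lrepr /= UactM /lactV0 VdegE //.
  by have := Uact_Vdeg (svalP x) (Vdeg_inj y); rewrite add0r.
Qed.

Lemma natmapE j u y : natmap (pure (@ractL j) lactV0 (lcl u) y)
  = Uact (sval u) (inj 0%N y).
Proof. by rewrite /natmap (tlift_pure (natmap_balanced j)) Uact_lrepr. Qed.

Definition generated_in_degree0 : Prop :=
  forall j (y : piece V j), exists t : PhiL lactV0 j, natmap t = inj j y.
End ModeAlgebra.

Arguments zhu {C}.
Arguments frakA {C}.
Arguments star {C V i j l}.

Definition connected_ring (A : pzRingType) : Prop :=
  forall e : A, e * e = e -> e = 0 \/ e = 1.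

Definition noetherian (A : pzRingType) : Prop :=
  forall I : set A, subgroup I -> (forall a x, I x -> I (a * x)) ->
    exists (n : nat) (g : 'I_n -> A),
      forall x, I x <-> exists c : 'I_n -> A, x = \sum_i c i * g i.

Definition projective (A : pzRingType) (M : lmodType A) : Prop :=
  forall (N N' : lmodType A) (g : {linear N -> N'}) (f : {linear M -> N'}),
    (forall y, exists x, g x = y) ->
    exists h : {linear M -> N}, forall x, g (h x) = f x.

Definition free_module (A : pzRingType) (M : lmodType A) : Prop :=
  exists (I : choiceType) (b : I -> M),
    (forall m, exists (s : seq I) (c : I -> A), m = \sum_(i <- s) c i *: b i) /\
    (forall (s : seq I) (c : I -> A), uniq s -> \sum_(i <- s) c i *: b i = 0 ->
       forall i, i \in s -> c i = 0).

(* An additive bijection preserving products; it maps the unit of the algebra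
   [frakA V j j], when there is one, to that of [B]. *)
Definition mode_algebra_iso (C : numFieldType) (V : voa C) (j : nat)
    (B : pzRingType) : Prop :=
  exists f : {additive frakA V j j -> B},
    bijective f /\ forall s t : frakA V j j, f (star s t) = f s * f t.

(* A is isomorphic to the product ring of the [B i]: the homomorphism to the
   product is given by its components, and bijectivity is the existence of a
   unique antecedent for each family. *)
Definition iso_to_prod (A : pzRingType) (n : nat) (B : 'I_n -> pzRingType) : Prop :=
  exists f : forall i, {rmorphism A -> B i},
    forall y : (forall i, B i), exists! x : A, forall i, f i x = y i.

(* Main.v *)
(* Each Phi^L(A)_j is a right A-module. Writing the strong unit of the j-th mode
   transition algebra as 1_j = \sum_i x_i (x) y_i, the two unit laws say that the
   x_i and the <y_i, -> form dual bases of Phi^L(A)_j, whose dual is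
   Phi^R(A)_{-j}. So Phi^L(A)_j is finitely generated projective, hence free of
   some rank n, and the mode transition algebra is its endomorphism algebra
   Mat_n(A).

   The rank is read off after specializing along the character A -> C given by
   V_0 = C vac: the map Phi^L(V_0)_j -> V_j is onto because V is generated in
   degree 0, and injective because u = \sum_i x_i <y_i, u> is determined by the
   classes of the y_i u, which act on vac. Hence n = dim V_j.

   Finally U_0 acts on the Phi^L(A)_j for j <= d through the level-d Zhu algebra.
   An element of U_0 lying in U U_{<= -j} that kills Phi^L(A)_j equals its product
   with 1_j modulo U U_{<= -j-1}, hence lies in U U_{<= -j-1}, so by induction
   the action is faithful. Products uv with deg u = j = - deg v realize every
   endomorphism of Phi^L(A)_j and kill Phi^L(A)_i for i < j, so any family of
   endomorphisms is realized by successive corrections. *)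
Require Import Defs.
From HB Require Import structures.
From mathcomp Require Import all_boot all_order all_algebra complex.
From mathcomp Require Import boolp classical_sets reals.
From mathcomp Require Import zify.

Set Implicit Arguments.
Unset Strict Implicit.
Unset Printing Implicit Defensive.
Import Order.TTheory GRing.Theory Num.Theory.
Local Open Scope ring_scope.

(** * Additive maps and finite sums *)

Lemma morphD0 (G H : zmodType) (f : G -> H) :
  {morph f : x y / x + y} -> f 0 = 0.
Proof. by move=> fD; apply: (addrI (f 0)); rewrite -fD !addr0. Qed.

Lemma morphD_sum (G H : zmodType) (f : G -> H) I (r : seq I) (F : I -> G) :
  {morph f : x y / x + y} -> f (\sum_(i <- r) F i) = \sum_(i <- r) f (F i).
Proof.
move=> fD; elim/big_rec2: _ => [|i _ y _ <-]; first exact: morphD0.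
exact: fD.
Qed.

(** Additivity is asked only on a subgroup because the class maps [zcl], [clL] and [clR] below are
    additive only on a homogeneous component. *)
Lemma subgroup_morph0 (G H : zmodType) (S : set G) (f : G -> H) :
  subgroup S -> (forall x y, S x -> S y -> f (x + y) = f x + f y) -> f 0 = 0.
Proof.
by move=> sS fD; apply: (addrI (f 0)); rewrite -fD ?addr0 //; exact: subgroup0.
Qed.

Lemma subgroup_morph_sum (G H : zmodType) (S : set G) (f : G -> H) n (F : 'I_n -> G) :
  subgroup S -> (forall x y, S x -> S y -> f (x + y) = f x + f y) ->
  (forall i, S (F i)) -> f (\sum_i F i) = \sum_i f (F i).
Proof.
move=> sS fD SF; suff [] : S (\sum_i F i) /\ f (\sum_i F i) = \sum_i f (F i) by [].
elim/big_rec2: _ => [|i y x _ [Sx <-]].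
  by split; [exact: subgroup0 sS|exact: subgroup_morph0 sS fD].
by rewrite fD //; split=> //; exact: subgroupD.
Qed.

(** * Homogeneous representatives in U of classes in the Zhu algebras and in Phi^L(A), Phi^R(A) *)

Section Classes.
Variables (C : numFieldType) (V : voa C).
Local Notation UU := (UU V).
Local Notation Uhom := (@Uhom C V).
Local Notation Lid := (@Lid C V).
Local Notation A := (zhu V 0).
Local Notation PhiLA := (PhiL (@lactA C V)).
Local Notation PhiRA := (PhiR (@ractA C V)).

Lemma UhomD k x y : Uhom k x -> Uhom k y -> Uhom k (x + y).
Proof. by move=> hx hy; apply: (subgroupD (Uhom_subgroup V k)). Qed.

Lemma Uhom_sum k n (f : 'I_n -> UU) :
  (forall i, Uhom k (f i)) -> Uhom k (\sum_i f i).
Proof. by move=> hf; apply: (subgroup_sum (Uhom_subgroup V k)). Qed.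

Lemma UhomM_eq k l m x y : k + l = m -> Uhom k x -> Uhom l y -> Uhom m (x * y).
Proof. by move=> <-; exact: UhomM. Qed.

Lemma LidS m m' k x : (m <= m')%R -> Lid m' k x -> Lid m k x.
Proof.
move=> le_m [hx cx]; split=> // N; have [y hy ny] := cx N; exists y => //.
by apply: lidealS hy; rewrite lerN2.
Qed.

Lemma lideal_Lid m k x : lideal Uhom (- m) k x -> Lid m k x.
Proof.
move=> hx; split; first exact: (lideal_sub (Uhom_subgroup V) (@UhomM _ V) hx).
by move=> N; exists x => //; rewrite subrr; exact: subgroup0 (nbhd_subgroup _ _ _).
Qed.

Lemma Lid_full m k x : (m <= - k)%R -> Uhom k x -> Lid m k x.
Proof.
move=> hm hx; apply: lideal_Lid.
exists 1%N, (fun=> k), (fun=> 1), (fun=> x); rewrite big_ord1 mul1r; split=> // _.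
by split=> //; [rewrite lerNr | rewrite subrr; exact: Uhom1].
Qed.

(** Constant sequences carry a sum of products u_i v_i from the uncompleted algebra to U without
    changing the degrees of the factors. *)
Lemma lideal_cst m k (u : ufin V) (cu : cseq (ucst u)) :
  lideal (@uhom C V) m k u -> lideal Uhom m k (ulim cu).
Proof.
move=> [n [l [a [b [h e]]]]].
have ca i : cauchy (k - l i) (ucst (a i)).
  by apply: cauchy_cst; have [] := h i.
have cb i : cauchy (l i) (ucst (b i)).
  by apply: cauchy_cst; have [] := h i.
exists n, l, (fun i => hlim (ca i)), (fun i => hlim (cb i)); split.
  move=> i; have [h1 h2 h3] := h i; split=> //.
    by exists (ucst (a i)), (ca i).
  by exists (ucst (b i)), (cb i).
(* [ulim] takes a proof of [cseq], so the sum cannot simply be rewritten under it; the induction on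
   lists builds this proof along with the value. *)
have cs (s : seq 'I_n) : exists c : cseq (ucst (\sum_(i <- s) a i * b i)),
    ulim c = \sum_(i <- s) hlim (ca i) * hlim (cb i).
  elim: s => [|i s [c' IH]].
    have c0 := subgroup0 (@cseq_subgroup C V).
    have c0' : cseq (ucst (\sum_(i <- [::]) a i * b i)) by rewrite big_nil.
    exists c0'; rewrite [RHS]big_nil; apply: etrans (esym (@zpi0 (UU_setoid V))).
    by apply: ulim_irr; apply/funext => p; rewrite /ucst big_nil.
  have c1 := cseqM (cseq_hom (ca i)) (cseq_hom (cb i)).
  have c2 := cseq_D c1 c'.
  have e2 : (fun=> a i * b i + \sum_(j <- s) a j * b j)
      = ucst (\sum_(j <- i :: s) a j * b j).
    by apply/funext => p; rewrite /ucst big_cons.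
  have c3 : cseq (ucst (\sum_(j <- i :: s) a j * b j)) by rewrite -e2.
  exists c3; rewrite [RHS]big_cons -IH /hlim ulimM -[RHS](@zpiD (UU_setoid V)).
  exact: ulim_irr.
have [c <-] := cs (index_enum 'I_n).
by apply: ulim_irr; rewrite e.
Qed.

(** To any order N, the class of a Cauchy sequence is approximated by one of its own late terms,
    taken as a constant. Beyond [n0] this term lies in the ideal, so the class lies in the
    closure. *)
Lemma nbhd_Lid m k x : nbhd (- m) k x -> Lid m k x.
Proof.
move=> [s [cs [[n0 h] ->]]]; split; first by exists s, cs.
move=> N; have [n1 h1] := cs.2 N; pose p := maxn n0 n1.
have hp : cauchy k (ucst (s p)) by apply: cauchy_cst; exact: cs.1.
exists (hlim hp); first by apply: lideal_cst; apply: h; rewrite leq_maxl.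
eexists _, (subgroupB (cauchy_subgroup V k) cs hp); split.
  by exists n1 => n hn; apply: h1; rewrite ?leq_maxr.
by rewrite /hlim ulimB; exact: ulim_irr.
Qed.

(* Only the summands u v with deg v = - j survive modulo U U_{<= - j - 1}. *)
Lemma Lid_decomp (j : int) x : Lid j 0 x ->
  exists (n : nat) (u v : 'I_n -> UU),
    (forall i, Uhom j (u i) /\ Uhom (- j) (v i)) /\
    Lid (j + 1) 0 (x - \sum_i u i * v i).
Proof.
(* Order j + 1 suffices: by [nbhd_Lid] the error of the approximation [y] lies in
   [Lid (j + 1) 0]. *)
move=> [hx cx]; have [y [n [l [u [v [h ->]]]]] /nbhd_Lid ny] := cx (j + 1).
pose P i := l i == - j.
exists n, (fun i => if P i then u i else 0), (fun i => if P i then v i else 0).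
split.
  move=> i; have [h1 h2 h3] := h i; rewrite /P; case: eqP => e; last first.
    by split; exact: subgroup0 (Uhom_subgroup V _).
  by rewrite -e; split=> //; move: h2; rewrite e opprK add0r.
rewrite -(subrKA (\sum_i u i * v i)); apply: (subgroupD (Lid_subgroup V _ _)) => //.
rewrite -sumrB; apply: (subgroup_sum (Lid_subgroup V _ _)) => i.
have [h1 h2 h3] := h i; rewrite /P; case: eqP => e.
  by rewrite subrr; exact: subgroup0 (Lid_subgroup V _ _).
(* Here [l i <= - j - 1], so the right factor alone already lies in [Lid (j + 1)]. *)
rewrite mul0r subr0; apply: (Lid_mull_eq _ h2); last first.
  by apply: Lid_full h3; lia.
by rewrite subrK.
Qed.

Lemma lclD j x y (hx : Uhom j%:Z x) (hy : Uhom j%:Z y) :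
  lcl (exist _ (x + y) (UhomD hx hy)) = lcl (exist _ x hx) + lcl (exist _ y hy).
Proof.
rewrite -[RHS]zpiD; apply/lclE; rewrite /= subrr.
exact: subgroup0 (Lid_subgroup V _ _).
Qed.

Lemma zhu_clD d x y (hx : Uhom 0 x) (hy : Uhom 0 y) :
  zhu_cl d (exist _ (x + y) (UhomD hx hy))
  = zhu_cl d (exist _ x hx) + zhu_cl d (exist _ y hy).
Proof.
rewrite -[RHS](@rpiD (zhu_setoid V d)); apply/zhu_clE; rewrite /= subrr.
exact: subgroup0 (Lid_subgroup V _ _).
Qed.

Lemma zhu_clM d x y (hx : Uhom 0 x) (hy : Uhom 0 y) :
  zhu_cl d (exist _ (x * y) (Uhom0M hx hy))
  = zhu_cl d (exist _ x hx) * zhu_cl d (exist _ y hy).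
Proof.
rewrite -[RHS](@rpiM (zhu_setoid V d)); apply/zhu_clE; rewrite /= subrr.
exact: subgroup0 (Lid_subgroup V _ _).
Qed.

Lemma zhu_cl_ex d (a : zhu V d) : exists x (hx : Uhom 0 x), a = zhu_cl d (exist _ x hx).
Proof. by rewrite -(rreprK a); case: (zrepr a) => x hx; exists x, hx. Qed.

Lemma lcl_ex j (p : Lq V j) : exists x (hx : Uhom j%:Z x), p = lcl (exist _ x hx).
Proof. by rewrite -(lqreprK p); case: (lrepr p) => x hx; exists x, hx. Qed.

Lemma rclD j x y (hx : Uhom (- j%:Z) x) (hy : Uhom (- j%:Z) y) :
  rcl (exist _ (x + y) (UhomD hx hy)) = rcl (exist _ x hx) + rcl (exist _ y hy).
Proof.
rewrite -[RHS]zpiD; apply/rclE; rewrite /= subrr.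
exact: subgroup0 (Rid_subgroup V _ _).
Qed.

Lemma rcl_ex j (q : Rq V j) : exists x (hx : Uhom (- j%:Z) x), q = rcl (exist _ x hx).
Proof. by rewrite -(rqreprK q); case: (rrepr q) => x hx; exists x, hx. Qed.

(* [zcl], [clL] and [clR] are total on U: they send an element outside the
   homogeneous component concerned to the junk value 0. *)
Definition zcl (d : nat) (x : UU) : zhu V d :=
  if pselect (Uhom 0 x) is left h then zhu_cl d (exist _ x h) else 0.

Lemma zcl_sub d x (h : Uhom 0 x) : zcl d x = zhu_cl d (exist _ x h).
Proof.
rewrite /zcl; case: pselect => // h'; apply/zhu_clE; rewrite subrr.
exact: subgroup0 (Lid_subgroup V _ _).
Qed.

Lemma zclE d x y : Uhom 0 x -> Uhom 0 y ->
  zcl d x = zcl d y <-> Lid (d%:Z + 1) 0 (x - y).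
Proof. by move=> hx hy; rewrite !zcl_sub; exact: zhu_clE. Qed.

Lemma zcl_surj d (a : zhu V d) : exists2 x, Uhom 0 x & zcl d x = a.
Proof.
by have [x [hx ->]] := zhu_cl_ex a; exists x => //; exact: zcl_sub.
Qed.

Lemma zclD d x y : Uhom 0 x -> Uhom 0 y -> zcl d (x + y) = zcl d x + zcl d y.
Proof.
move=> hx hy; rewrite (zcl_sub _ hx) (zcl_sub _ hy) (zcl_sub _ (UhomD hx hy)).
exact: zhu_clD.
Qed.

Lemma zclM d x y : Uhom 0 x -> Uhom 0 y -> zcl d (x * y) = zcl d x * zcl d y.
Proof.
move=> hx hy; rewrite (zcl_sub _ hx) (zcl_sub _ hy) (zcl_sub _ (Uhom0M hx hy)).
exact: zhu_clM.
Qed.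

Lemma zcl1 d : zcl d 1 = 1.
Proof.
rewrite (zcl_sub _ (@Uhom1 C V)) -[RHS](@rpi1 (zhu_setoid V d)); apply/zhu_clE.
by rewrite /= subrr; exact: subgroup0 (Lid_subgroup V _ _).
Qed.

Lemma zcl0 d : zcl d 0 = 0.
Proof. exact: subgroup_morph0 (Uhom_subgroup V 0) (@zclD d). Qed.

Lemma zcl_eq0 d x : Uhom 0 x -> zcl d x = 0 <-> Lid (d%:Z + 1) 0 x.
Proof.
move=> hx; rewrite -(zcl0 d) -{2}(subr0 x); apply: zclE => //.
exact: subgroup0 (Uhom_subgroup V _).
Qed.

Definition clL (j : nat) (u : UU) : PhiLA j :=
  if pselect (Uhom j%:Z u) is left h then pure _ _ (lcl (exist _ u h)) 1 else 0.

Definition clR (j : nat) (v : UU) : PhiRA j :=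
  if pselect (Uhom (- j%:Z) v) is left h then pure _ _ 1 (rcl (exist _ v h))
  else 0.

Lemma clL_sub j u (h : Uhom j%:Z u) : clL j u = pure _ _ (lcl (exist _ u h)) 1.
Proof.
rewrite /clL; case: pselect => // h'; congr (pure _ _ _ _); apply/lclE.
by rewrite subrr; exact: subgroup0 (Lid_subgroup V _ _).
Qed.

Lemma clR_sub j v (h : Uhom (- j%:Z) v) : clR j v = pure _ _ 1 (rcl (exist _ v h)).
Proof.
rewrite /clR; case: pselect => // h'; congr (pure _ _ _ _); apply/rclE.
by rewrite subrr; exact: subgroup0 (Rid_subgroup V _ _).
Qed.

Lemma clLD j u v : Uhom j%:Z u -> Uhom j%:Z v -> clL j (u + v) = clL j u + clL j v.
Proof.
move=> hu hv; rewrite (clL_sub hu) (clL_sub hv) (clL_sub (UhomD hu hv)) -pureDl.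
by rewrite lclD.
Qed.

Lemma clRD j u v : Uhom (- j%:Z) u -> Uhom (- j%:Z) v ->
  clR j (u + v) = clR j u + clR j v.
Proof.
move=> hu hv; rewrite (clR_sub hu) (clR_sub hv) (clR_sub (UhomD hu hv)) -pureDr.
by rewrite rclD.
Qed.

Lemma clL0 j : clL j 0 = 0.
Proof. exact: subgroup_morph0 (Uhom_subgroup V j%:Z) (@clLD j). Qed.

Lemma clL_sum j n (F : 'I_n -> UU) :
  (forall i, Uhom j%:Z (F i)) -> clL j (\sum_i F i) = \sum_i clL j (F i).
Proof. exact: subgroup_morph_sum (Uhom_subgroup V j%:Z) (@clLD j). Qed.

Lemma clR0 j : clR j 0 = 0.
Proof. exact: subgroup_morph0 (Uhom_subgroup V (- j%:Z)) (@clRD j). Qed.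

Lemma clR_sum j n (F : 'I_n -> UU) :
  (forall i, Uhom (- j%:Z) (F i)) -> clR j (\sum_i F i) = \sum_i clR j (F i).
Proof. exact: subgroup_morph_sum (Uhom_subgroup V (- j%:Z)) (@clRD j). Qed.

Lemma clLM j u x : Uhom j%:Z u -> Uhom 0 x ->
  clL j (u * x) = ractPhi (clL j u) (zcl 0 x).
Proof.
move=> hu hx; rewrite (clL_sub hu) ractPhiE mul1r.
rewrite (clL_sub (UhomM_eq (addr0 _) hu hx)) (zcl_sub _ hx).
rewrite -[zhu_cl _ _]mulr1 -[_ * 1]/(lactA _ _) -pure_bal ractLE.
congr (pure _ _ _ _); apply/lclE; rewrite /= subrr.
exact: subgroup0 (Lid_subgroup V _ _).
Qed.

Lemma clRM j x v : Uhom 0 x -> Uhom (- j%:Z) v ->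
  clR j (x * v) = lactPhi (zcl 0 x) (clR j v).
Proof.
move=> hx hv; rewrite (clR_sub hv) lactPhiE mulr1.
rewrite (clR_sub (UhomM_eq (add0r _) hx hv)) (zcl_sub _ hx).
rewrite -[zhu_cl _ _]mul1r -[1 * _]/(ractA _ _) pure_bal lactRE.
congr (pure _ _ _ _); apply/rclE; rewrite /= subrr.
exact: subgroup0 (Rid_subgroup V _ _).
Qed.

(** Since u (x) [x] = u x (x) 1, every tensor collapses to the class of a single homogeneous
    element. *)
Lemma clL_surj j (p : PhiLA j) : exists2 u, Uhom j%:Z u & clL j u = p.
Proof.
move: p; apply: tensor_ind => [|p a t [u hu <-]].
  by exists 0; [exact: subgroup0 (Uhom_subgroup V _)|exact: clL0].
have [x hx <-] := zcl_surj a; have hp := svalP (lrepr p).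
exists (sval (lrepr p) * x + u).
  by apply: UhomD => //; exact: UhomM_eq (addr0 _) hp hx.
rewrite clLD //; last exact: UhomM_eq (addr0 _) hp hx.
rewrite clLM // (clL_sub hp) ractPhiE mul1r; congr (pure _ _ _ _ + _).
rewrite -[RHS]lqreprK; apply/lclE; rewrite /= subrr.
exact: subgroup0 (Lid_subgroup V _ _).
Qed.

Lemma clR_surj j (q : PhiRA j) : exists2 v, Uhom (- j%:Z) v & clR j v = q.
Proof.
move: q; apply: tensor_ind => [|a q t [v hv <-]].
  by exists 0; [exact: subgroup0 (Uhom_subgroup V _)|exact: clR0].
have [x hx <-] := zcl_surj a; have hq := svalP (rrepr q).
exists (x * sval (rrepr q) + v).
  by apply: UhomD => //; exact: UhomM_eq (add0r _) hx hq.
rewrite clRD //; last exact: UhomM_eq (add0r _) hx hq.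
rewrite clRM // (clR_sub hq) lactPhiE mulr1; congr (pure _ _ _ _ + _).
rewrite -[RHS]rqreprK; apply/rclE; rewrite /= subrr.
exact: subgroup0 (Rid_subgroup V _ _).
Qed.

(** Tensoring with A adds no relation: the map p (x) [x] |-> p x is balanced and is a left inverse
    of p |-> p (x) 1. *)
Lemma clL_eq0 j u : Uhom j%:Z u -> clL j u = 0 <-> Lid 1 j%:Z u.
Proof.
move=> hu; split=> h; last first.
  have h0 := subgroup0 (Uhom_subgroup V j%:Z).
  rewrite -(clL0 j) (clL_sub hu) (clL_sub h0); congr (pure _ _ _ _).
  by apply/lclE; rewrite /= subr0.
pose f (p : Lq V j) (a : A) : Lq V j := ractL p (zrepr a).
(* The choice made by [zrepr] is harmless: two representatives differ by an element of [Lid 1 0],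
   which left multiplication by [x] sends into [Lid 1 j]. *)
have fE x (hx : Uhom j%:Z x) y (hy : Uhom 0 y) :
    f (lcl (exist _ x hx)) (zhu_cl 0 (exist _ y hy)) =
      lcl (exist _ (x * y) (UhomM_eq (addr0 _) hx hy)).
  rewrite /f ractLE; apply/lclE; rewrite /= -mulrBr.
  apply: Lid_mull_eq (addr0 _) hx _.
  by apply/(@zhu_clE C V 0 _ (exist _ y hy)); exact: rreprK.
have bf : balanced (@ractL C V j) (@lactA C V) f.
  split=> [p q a|p a b|p x a].
  - have [x [hx ->]] := lcl_ex p; have [y [hy ->]] := lcl_ex q.
    have [z [hz ->]] := zhu_cl_ex a; rewrite -lclD !fE -lclD.
    apply/lclE; rewrite /= mulrDl subrr; exact: subgroup0 (Lid_subgroup V _ _).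
  - have [x [hx ->]] := lcl_ex p; have [y [hy ->]] := zhu_cl_ex a.
    have [z [hz ->]] := zhu_cl_ex b; rewrite -zhu_clD !fE -lclD.
    apply/lclE; rewrite /= mulrDr subrr; exact: subgroup0 (Lid_subgroup V _ _).
  - have [y [hy ->]] := lcl_ex p; have [z [hz ->]] := zhu_cl_ex a.
    case: x => x hx; have hyx := UhomM_eq (addr0 _) hy hx.
    have -> : ractL (lcl (exist _ y hy)) (exist _ x hx) = lcl (exist _ (y * x) hyx).
      rewrite ractLE; apply/lclE; rewrite /= subrr.
      exact: subgroup0 (Lid_subgroup V _ _).
    rewrite /lactA -zhu_clM !fE.
    apply/lclE; rewrite /= mulrA subrr; exact: subgroup0 (Lid_subgroup V _ _).
have e : tlift f (clL j u) = 0 by rewrite h -[X in _ = X](zpi0 _) (tlift_pi bf) big_nil.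
move: e; rewrite (clL_sub hu) (tlift_pure bf) -(zcl1 0) (zcl_sub _ (@Uhom1 C V)).
have h0 := subgroup0 (Uhom_subgroup V j%:Z).
have <- : lcl (exist _ 0 h0) = 0 :> Lq V j.
  apply: (addrI (lcl (exist _ 0 h0))); rewrite -lclD [RHS]addr0.
  by apply/lclE; rewrite /= addr0 subrr; exact: subgroup0 (Lid_subgroup V _ _).
by rewrite fE => /lclE /=; rewrite subr0 mulr1.
Qed.

(** Mirror image of [clL_eq0]. The conclusion is about a left ideal because, in a product of total
    degree -j, the left factor has degree >= 1 exactly when the right one has degree <= -j-1. *)
Lemma clR_eq0 j v : Uhom (- j%:Z) v -> clR j v = 0 -> Lid (1 + j%:Z) (- j%:Z) v.
Proof.
move=> hv h.
pose f (a : A) (q : Rq V j) : Rq V j := lactR (zrepr a) q.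
have fE x (hx : Uhom (- j%:Z) x) y (hy : Uhom 0 y) :
    f (zhu_cl 0 (exist _ y hy)) (rcl (exist _ x hx)) =
      rcl (exist _ (y * x) (UhomM_eq (add0r _) hy hx)).
  rewrite /f lactRE; apply/rclE; rewrite /= -mulrBl RidE.
  apply: Lid_mulr_eq (add0r _) hx _; last first.
    by apply/(@zhu_clE C V 0 _ (exist _ y hy)); exact: rreprK.
  by rewrite add0r.
have bf : balanced (@ractA C V) (@lactR C V j) f.
  split=> [a b p|a p q|a x p].
  - have [x [hx ->]] := rcl_ex p; have [y [hy ->]] := zhu_cl_ex a.
    have [z [hz ->]] := zhu_cl_ex b; rewrite -zhu_clD !fE -rclD.
    apply/rclE; rewrite /= mulrDl subrr; exact: subgroup0 (Rid_subgroup V _ _).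
  - have [x [hx ->]] := rcl_ex p; have [y [hy ->]] := rcl_ex q.
    have [z [hz ->]] := zhu_cl_ex a; rewrite -rclD !fE -rclD.
    apply/rclE; rewrite /= mulrDr subrr; exact: subgroup0 (Rid_subgroup V _ _).
  - have [y [hy ->]] := rcl_ex p; have [z [hz ->]] := zhu_cl_ex a.
    case: x => x hx; have hyx := UhomM_eq (add0r _) hx hy.
    have -> : lactR (exist _ x hx) (rcl (exist _ y hy)) = rcl (exist _ (x * y) hyx).
      rewrite lactRE; apply/rclE; rewrite /= subrr.
      exact: subgroup0 (Rid_subgroup V _ _).
    rewrite /ractA -zhu_clM !fE.
    apply/rclE; rewrite /= mulrA subrr; exact: subgroup0 (Rid_subgroup V _ _).
have e : tlift f (clR j v) = 0 by rewrite h -[X in _ = X](zpi0 _) (tlift_pi bf) big_nil.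
move: e; rewrite (clR_sub hv) (tlift_pure bf) -(zcl1 0) (zcl_sub _ (@Uhom1 C V)).
have h0 := subgroup0 (Uhom_subgroup V (- j%:Z)).
have <- : rcl (exist _ 0 h0) = 0 :> Rq V j.
  apply: (addrI (rcl (exist _ 0 h0))); rewrite -rclD [RHS]addr0.
  by apply/rclE; rewrite /= addr0 subrr; exact: subgroup0 (Rid_subgroup V _ _).
by rewrite fE => /rclE /=; rewrite subr0 mul1r RidE opprK.
Qed.

Lemma pairing_cl j v u : Uhom (- j%:Z) v -> Uhom j%:Z u ->
  pairing (clR j v) (clL j u) = zcl 0 (v * u).
Proof.
move=> hv hu; rewrite (clL_sub hu) (clR_sub hv) pairingE mul1r mulr1 brkE.
rewrite (zcl_sub _ (UhomM_eq (addNr _) hv hu)); apply/zhu_clE; rewrite /= subrr.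
exact: subgroup0 (Lid_subgroup V _ _).
Qed.

Lemma zcl_lift d n (p : 'I_n -> zhu V d) :
  exists u : 'I_n -> UU, forall i, Uhom 0 (u i) /\ zcl d (u i) = p i.
Proof.
have ex i : exists u, Uhom 0 u /\ zcl d u = p i.
  by have [u] := zcl_surj (p i); exists u.
by have [u hu] := choice ex; exists u.
Qed.

Lemma clL_lift j n (p : 'I_n -> PhiLA j) :
  exists u : 'I_n -> UU, forall i, Uhom j%:Z (u i) /\ clL j (u i) = p i.
Proof.
have ex i : exists u, Uhom j%:Z u /\ clL j u = p i.
  by have [u] := clL_surj (p i); exists u.
by have [u hu] := choice ex; exists u.
Qed.

Lemma clR_lift j n (p : 'I_n -> PhiRA j) :
  exists u : 'I_n -> UU, forall i, Uhom (- j%:Z) (u i) /\ clR j (u i) = p i.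
Proof.
have ex i : exists u, Uhom (- j%:Z) u /\ clR j u = p i.
  by have [u] := clR_surj (p i); exists u.
by have [u hu] := choice ex; exists u.
Qed.

End Classes.

Lemma tensor_sum (P Q : zmodType) (S : Type) (ra : P -> S -> P) (la : S -> Q -> Q)
    (t : tensor ra la) :
  exists (n : nat) (p : 'I_n -> P) (q : 'I_n -> Q),
    t = \sum_i pure ra la (p i) (q i).
Proof.
move: t; apply: tensor_ind => [|p q _ [n [x [y ->]]]].
  by exists 0%N, (fun=> 0), (fun=> 0); rewrite big_ord0.
exists n.+1, (fun i => oapp x p (unlift ord0 i)), (fun i => oapp y q (unlift ord0 i)).
rewrite big_ord_recl unlift_none; congr (_ + _); apply: eq_bigr => i _.
by rewrite liftK.
Qed.

(** * Dual bases from the strong unit *)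

Section DualBasis.
Variables (C : numFieldType) (V : voa C).
Local Notation A := (zhu V 0).
Local Notation PhiLA := (PhiL (@lactA C V)).
Local Notation PhiRA := (PhiR (@ractA C V)).

Lemma ractPhi1 j (p : PhiLA j) : ractPhi p 1 = p.
Proof.
move: p; apply: (@tensor_ext _ _ _ _ _ _ (fun t => ractPhi t 1) id) => [s t||u a] //.
  exact: ractPhiDl.
by rewrite ractPhiE mulr1.
Qed.

Lemma lactPhi1 j (q : PhiRA j) : lactPhi 1 q = q.
Proof.
move: q; apply: (@tensor_ext _ _ _ _ _ _ (lactPhi 1) id) => [s t||u a] //.
  exact: lactPhiDr.
by rewrite lactPhiE mul1r.
Qed.

Lemma lactPhi_suml j I (r : seq I) (F : I -> A) (q : PhiRA j) :
  lactPhi (\sum_(i <- r) F i) q = \sum_(i <- r) lactPhi (F i) q.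
Proof.
have D : {morph (fun a : A => lactPhi a q) : x y / x + y}.
  by move=> x y; exact: lactPhiDl.
exact: (morphD_sum r F D).
Qed.
Lemma pairing_suml j I (r : seq I) (F : I -> PhiRA j) (p : PhiLA j) :
  pairing (\sum_(i <- r) F i) p = \sum_(i <- r) pairing (F i) p.
Proof.
have D : {morph (fun q : PhiRA j => pairing q p) : x y / x + y}.
  by move=> x y; exact: pairingDl.
exact: (morphD_sum r F D).
Qed.
Lemma pairing_sumr j I (r : seq I) (F : I -> PhiLA j) (q : PhiRA j) :
  pairing q (\sum_(i <- r) F i) = \sum_(i <- r) pairing q (F i).
Proof.
have D : {morph (pairing q) : x y / x + y}.
  by move=> x y; exact: pairingDr.
exact: (morphD_sum r F D).
Qed.

Definition dual_bases j n (x : 'I_n -> PhiLA j) (y : 'I_n -> PhiRA j) : Prop :=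
  (forall p, p = \sum_i ractPhi (x i) (pairing (y i) p)) /\
  (forall q, q = \sum_i lactPhi (pairing q (x i)) (y i)).

(* The unit of the j-th mode transition algebra, written as the sum of the
   x_i (x) y_i, acts as the identity on Phi^L(A)_j = frakA_{j,0} and on
   Phi^R(A)_{-j} = frakA_{0,-j}. *)
Lemma strongly_unital_dual_bases j : strongly_unital V j ->
  exists (n : nat) (x : 'I_n -> PhiLA j) (y : 'I_n -> PhiRA j), dual_bases x y.
Proof.
move=> [e [er el]]; have [n [x [y e_eq]]] := tensor_sum e.
have star_suml l (t : frakA V j l) :
    star e t = \sum_i star (pure _ _ (x i) (y i)) t.
  have D : {morph (fun s : frakA V j j => star s t) : s s' / s + s'}.
    by move=> s s'; exact: starDl.
  rewrite e_eq; exact: (morphD_sum _ _ D).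
have star_sumr k (t : frakA V k j) :
    star t e = \sum_i star t (pure _ _ (x i) (y i)).
  have D : {morph (fun s : frakA V j j => star t s) : s s' / s + s'}.
    by move=> s s'; exact: starDr.
  rewrite e_eq; exact: (morphD_sum _ _ D).
(* As <r1, l1> = 1, p |-> p (x) r1 embeds Phi^L(A)_j in frakA_{j,0} and q |-> l1 (x) q embeds
   Phi^R(A)_{-j} in frakA_{0,-j}. The maps [f] below are left inverses of these embeddings. *)
pose l1 := clL 0 (1 : UU V); pose r1 := clR 0 (1 : UU V).
have rl1 : pairing r1 l1 = 1.
  by rewrite pairing_cl ?mulr1 ?zcl1 //; exact: Uhom1.
exists n, x, y; split=> [p|q].
  pose f (al : PhiLA j) (be : PhiRA 0) := ractPhi al (pairing be l1).
  have bf : balanced (@ractPhi C V j) (@lactPhi C V 0) f.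
    split=> [a a' b|a b b'|a c b]; rewrite /f.
    - exact: ractPhiDl.
    - by rewrite pairingDl ractPhiDr.
    - by rewrite pairing_lact ractPhiM.
  have := congr1 (tlift f) (el (pure _ _ p r1)).
  rewrite star_suml (tlift_pure bf) [f p r1]/f rl1 ractPhi1 => {1}<-.
  rewrite (morphD_sum _ _ (tliftD bf)).
  apply: eq_bigr => i _; rewrite starE (tlift_pure bf) /f pairing_lact.
  by rewrite rl1 mulr1.
pose f (al : PhiLA 0) (be : PhiRA j) := lactPhi (pairing r1 al) be.
have bf : balanced (@ractPhi C V 0) (@lactPhi C V j) f.
  split=> [a a' b|a b b'|a c b]; rewrite /f.
  - by rewrite pairingDr lactPhiDl.
  - exact: lactPhiDr.
  - by rewrite pairing_ract lactPhiM.
have := congr1 (tlift f) (er (pure _ _ l1 q)).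
rewrite star_sumr (tlift_pure bf) [f l1 q]/f rl1 lactPhi1 => {1}<-.
rewrite (morphD_sum _ _ (tliftD bf)).
by apply: eq_bigr => i _; rewrite starE (tlift_pure bf) /f rl1 lactPhi1.
Qed.

(** Freeness is recorded by coordinate functions for the right action [ractPhi], so that its later
    uses do not go through the left module structure, which rests on commutativity of A. *)
Definition basis_coords j n (b : 'I_n -> PhiLA j) (c : PhiLA j -> 'I_n -> A) : Prop :=
  [/\ forall p q k, c (p + q) k = c p k + c q k,
      forall p a k, c (ractPhi p a) k = c p k * a,
      forall k l, c (b l) k = (k == l)%:R
    & forall p, p = \sum_k ractPhi (b k) (c p k)].

(** * Freeness of Phi^L(A)_j over A *)

Section Free.
Hypothesis A_comm : forall x y : A, x * y = y * x.
Hypothesis A_proj : forall M : lmodType A, projective M -> free_module M.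

(** The commutativity proof is a parameter of the type so that the right action can be declared on
    it as a left scaling. *)
Definition PhiLmod (h : forall x y : A, x * y = y * x) (j : nat) : Type := PhiLA j.
HB.instance Definition _ h j := GRing.Zmodule.on (PhiLmod h j).

Section Scale.
Variables (h : forall x y : A, x * y = y * x) (j : nat).
Let scale (a : A) (p : PhiLmod h j) : PhiLmod h j := ractPhi (p : PhiLA j) a.

Lemma PhiLmod_scalerA a b p : scale a (scale b p) = scale (a * b) p.
Proof. by rewrite /scale (h a) ractPhiM. Qed.
Lemma PhiLmod_scale1r : left_id 1 scale.
Proof. exact: ractPhi1. Qed.
Lemma PhiLmod_scalerDr : right_distributive scale +%R.
Proof. by move=> a p q; exact: ractPhiDl. Qed.
Lemma PhiLmod_scalerDl p : {morph scale^~ p : a b / a + b}.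
Proof. by move=> a b; exact: ractPhiDr. Qed.

HB.instance Definition _ := GRing.Zmodule_isLmodule.Build A (PhiLmod h j)
  PhiLmod_scalerA PhiLmod_scale1r PhiLmod_scalerDr PhiLmod_scalerDl.

Lemma PhiLmod_scaleE a (p : PhiLmod h j) : a *: p = ractPhi (p : PhiLA j) a.
Proof. by []. Qed.
End Scale.

(** Dual bases give the lift: choose preimages z_i of the f(x_i) and send p to the sum of the <y_i,
    p> z_i. *)
Lemma PhiLmod_projective j n (x : 'I_n -> PhiLA j) (y : 'I_n -> PhiRA j) :
  dual_bases x y -> projective (PhiLmod A_comm j).
Proof.
move=> [xy _] N N' g f g_surj.
have [z hz] := choice (fun i => g_surj (f (x i : PhiLmod A_comm j))).
pose h (p : PhiLmod A_comm j) : N := \sum_i pairing (y i) p *: z i.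
have hlin : linear h.
  move=> a p q; rewrite /h scaler_sumr -big_split; apply: eq_bigr => i _ /=.
  by rewrite pairingDr PhiLmod_scaleE pairing_ract scalerDl A_comm scalerA.
pose hL := GRing.isLinear.Build A (PhiLmod A_comm j) N *:%R h hlin.
pose h' : {linear PhiLmod A_comm j -> N} := HB.pack h hL.
exists h' => p; rewrite [RHS](_ : _ =
  f (\sum_i pairing (y i) p *: (x i : PhiLmod A_comm j))).
  rewrite /= /h !linear_sum; apply: eq_bigr => i _.
  by rewrite !linearZ /= hz.
by congr (f _); exact: xy.
Qed.

(** The basis given by freeness may have an infinite index type, but the finitely many basis vectors
    occurring in the generators x_i already span. *)
Lemma PhiL_basis j : strongly_unital V j ->
  exists (n : nat) (b : 'I_n -> PhiLA j) (c : PhiLA j -> 'I_n -> A), basis_coords b c.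
Proof.
move=> /strongly_unital_dual_bases [n [x [y xy]]].
have [I [b [bspan bfree]]] := A_proj (PhiLmod_projective xy).
have uniqc (s : seq I) (c c' : I -> A) : uniq s ->
    \sum_(i <- s) c i *: b i = \sum_(i <- s) c' i *: b i ->
    forall i, i \in s -> c i = c' i.
  move=> us e i si; apply: subr0_eq; apply: (bfree s (fun i => c i - c' i)) => //.
  under eq_bigr => k _ do rewrite scalerBl.
  by rewrite sumrB e subrr.
have [sx hsx] := choice (fun i : 'I_n => bspan (x i)).
pose s := undup (flatten [seq sx i | i <- enum 'I_n]).
have us : uniq s by exact: undup_uniq.
have span_s (p : PhiLmod A_comm j) : exists c, p = \sum_(i <- s) c i *: b i.
  pose P (p : PhiLmod A_comm j) := exists c, p = \sum_(i <- s) c i *: b i.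
  have P0 : P 0 by exists (fun=> 0); rewrite big1 // => i _; rewrite scale0r.
  have PD p1 p2 : P p1 -> P p2 -> P (p1 + p2).
    move=> [c1 ->] [c2 ->]; exists (fun i => c1 i + c2 i).
    by rewrite -big_split; apply: eq_bigr => i _; rewrite scalerDl.
  have PZ a p1 : P p1 -> P (a *: p1).
    move=> [c ->]; exists (fun i => a * c i).
    by rewrite scaler_sumr; apply: eq_bigr => i _; rewrite scalerA.
  have Pb i : i \in s -> P (b i).
    move=> si; exists (fun k => (k == i)%:R); rewrite (bigD1_seq i) //= eqxx scale1r.
    by rewrite big1 ?addr0 // => k /negPf ->; rewrite scale0r.
  suff: P p by [].
  rewrite [p](xy.1 p); apply: (big_ind P P0 PD) => i _.
  rewrite -[ractPhi _ _]/(pairing (y i) p *: (x i : PhiLmod A_comm j)); apply: (PZ).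
  have [c ->] := hsx i; rewrite big_seq; apply: (big_ind P P0 PD) => k ki.
  apply/PZ/Pb; rewrite mem_undup; apply/flattenP; exists (sx i) => //.
  by apply: map_f; rewrite mem_enum.
have [c hc] := choice span_s.
pose t := in_tuple s.
exists (size s), (fun k => b (tnth t k)), (fun p k => c p (tnth t k)).
have sumE (F : I -> PhiLmod A_comm j) : \sum_(i <- s) F i = \sum_k F (tnth t k).
  exact: big_tnth.
have tin k : tnth t k \in s by exact: mem_tnth.
split=> [p q k|p a k|k l|p].
- apply: (uniqc s (c (p + q)) (fun i => c p i + c q i)) => //.
  under [RHS]eq_bigr => i _ do rewrite scalerDl.
  by rewrite big_split /= -!hc.
- rewrite A_comm; apply: (uniqc s (c (ractPhi p a)) (fun i => a * c p i)) => //.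
  under [RHS]eq_bigr => i _ do rewrite -scalerA.
  by rewrite -scaler_sumr -!hc.
- rewrite -(inj_eq (f := tnth t)); last by apply/tuple_uniqP.
  apply: (uniqc s (c (b (tnth t l))) (fun i => (i == tnth t l)%:R)) => //.
  rewrite -hc (bigD1_seq (tnth t l)) //= eqxx scale1r.
  by rewrite big1 ?addr0 // => i /negPf ->; rewrite scale0r.
- by rewrite [LHS]hc sumE.
Qed.
End Free.
End DualBasis.

(** * The mode transition algebra as a matrix algebra *)

Section Coordinates.
Variables (C : numFieldType) (V : voa C) (j n : nat).
Local Notation A := (zhu V 0).
Local Notation PhiLA := (PhiL (@lactA C V)).
Local Notation PhiRA := (PhiR (@ractA C V)).
Variables (b : 'I_n -> PhiLA j) (c : PhiLA j -> 'I_n -> A).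
Hypothesis bc : basis_coords b c.

Lemma coordsD p q k : c (p + q) k = c p k + c q k. Proof. by case: bc. Qed.
Lemma coordsM p a k : c (ractPhi p a) k = c p k * a. Proof. by case: bc. Qed.
Lemma coords_basis k l : c (b l) k = (k == l)%:R. Proof. by case: bc. Qed.
Lemma coords_sum p : p = \sum_k ractPhi (b k) (c p k). Proof. by case: bc. Qed.

Lemma coords_lin I (r : seq I) (F : I -> PhiLA j) k :
  c (\sum_(i <- r) F i) k = \sum_(i <- r) c (F i) k.
Proof.
have D : {morph (fun p : PhiLA j => c p k) : p q / p + q}.
  by move=> p q; exact: coordsD.
exact: (morphD_sum r F D).
Qed.

Lemma coords_uniq (a : 'I_n -> A) l : c (\sum_k ractPhi (b k) (a k)) l = a l.
Proof.
rewrite coords_lin (bigD1 l) //= coordsM coords_basis eqxx mul1r big1 ?addr0 //.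
by move=> k kl; rewrite coordsM coords_basis eq_sym (negPf kl) mul0r.
Qed.

Hypothesis unital : strongly_unital V j.

(** From p = \sum_i x_i <y_i, p>, each coordinate is the pairing with \sum_i c(x_i)_k y_i. These
    elements form the basis of Phi^R(A)_{-j} dual to [b]. *)
Lemma coords_dual : exists be : 'I_n -> PhiRA j,
  (forall k p, pairing (be k) p = c p k) /\
  (forall q, q = \sum_l lactPhi (pairing q (b l)) (be l)).
Proof.
have [m [x [y [xyl xyr]]]] := strongly_unital_dual_bases unital.
exists (fun k => \sum_i lactPhi (c (x i) k) (y i)); split=> [k p|q].
  rewrite pairing_suml {2}(xyl p) coords_lin; apply: eq_bigr => i _.
  by rewrite pairing_lact coordsM.
rewrite {1}(xyr q).
transitivity (\sum_i \sum_l lactPhi (pairing q (b l) * c (x i) l) (y i)).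
  apply: eq_bigr => i _; rewrite -lactPhi_suml; congr (lactPhi _ _).
  rewrite {1}(coords_sum (x i)) pairing_sumr.
  by apply: eq_bigr => l _; rewrite pairing_ract.
rewrite exchange_big; apply: eq_bigr => l _.
have D : {morph (lactPhi (pairing q (b l)) : PhiRA j -> PhiRA j) : s t / s + t}.
  by move=> s t; exact: lactPhiDr.
rewrite (morphD_sum _ _ D); apply: eq_bigr => i _; exact: lactPhiM.
Qed.

(** The matrix in the basis [b] of the left action of [t] on Phi^L(A)_j, where p (x) q sends b_l to
    p <q, b_l>. *)
Definition mode_mx (t : frakA V j j) : 'M[A]_n :=
  tlift (fun p q => \matrix_(k, l) (c p k * pairing q (b l))) t.

Lemma mode_mx_balanced : balanced (@ractPhi C V j) (@lactPhi C V j)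
  (fun p q => \matrix_(k, l) (c p k * pairing q (b l)) : 'M[A]_n).
Proof.
split=> [p p' q|p q q'|p a q]; apply/matrixP => k l; rewrite !mxE.
- by rewrite coordsD mulrDl.
- by rewrite pairingDl mulrDr.
- by rewrite coordsM pairing_lact mulrA.
Qed.

Lemma mode_mxD : {morph mode_mx : s t / s + t}.
Proof. exact: tliftD mode_mx_balanced. Qed.

Lemma mode_mx_pure p q k l :
  mode_mx (pure _ _ p q) k l = c p k * pairing q (b l).
Proof. by rewrite /mode_mx (tlift_pure mode_mx_balanced) mxE. Qed.

Lemma mode_mxM s t : mode_mx (star s t) = mode_mx s * mode_mx t.
Proof.
have D1 (t' : frakA V j j) : {morph (fun s : frakA V j j => star s t') : s s' / s + s'}.
  by move=> s1 s2; exact: starDl.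
have D2 (s' : frakA V j j) : {morph (fun t : frakA V j j => star s' t) : s s' / s + s'}.
  by move=> s1 s2; exact: starDr.
have [n1 [p [q ->]]] := tensor_sum s; have [n2 [p' [q' ->]]] := tensor_sum t.
rewrite (morphD_sum _ _ (D1 _)) !(morphD_sum _ _ mode_mxD) mulr_suml.
apply: eq_bigr => i _.
rewrite (morphD_sum _ _ (D2 _)) (morphD_sum _ _ mode_mxD) mulr_sumr.
apply: eq_bigr => i' _; apply/matrixP => k l.
(* Expanding p' in the basis [b] turns <q, p'> into the sum over the middle index of the matrix
   product. *)
rewrite starE mode_mx_pure mxE pairing_lact {1}(coords_sum (p' i')) pairing_sumr.
rewrite mulr_suml mulr_sumr; apply: eq_bigr => m _.
by rewrite !mode_mx_pure pairing_ract !mulrA.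
Qed.

Lemma mode_mx_bij : bijective mode_mx.
Proof.
have [be [bel ber]] := coords_dual.
(* The matrix unit of position (k, l) comes from b_k (x) be_l. *)
pose g (M : 'M[A]_n) : frakA V j j :=
  \sum_k \sum_l pure (@ractPhi C V j) (@lactPhi C V j) (b k) (lactPhi (M k l) (be l)).
have gD : {morph g : M N / M + N}.
  move=> M N; rewrite /g -big_split; apply: eq_bigr => k _.
  rewrite -big_split; apply: eq_bigr => l _.
  by rewrite mxE lactPhiDl pureDr.
exists g => [t|M].
  have [m [p [q ->]]] := tensor_sum t.
  rewrite (morphD_sum _ _ mode_mxD) (morphD_sum _ _ gD); apply: eq_bigr => i _.
  have Dr (p' : PhiLA j) :
      {morph pure (@ractPhi C V j) (@lactPhi C V j) p' : s t / s + t}.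
    by move=> s1 s2; exact: pureDr.
  have Dl (q' : PhiRA j) :
      {morph (fun p => pure (@ractPhi C V j) (@lactPhi C V j) p q') : s t / s + t}.
    by move=> s1 s2; exact: pureDl.
  rewrite {2}(coords_sum (p i)) (morphD_sum _ _ (Dl _)); apply: eq_bigr => k _.
  rewrite pure_bal {2}(ber (q i)).
  have D : {morph (lactPhi (c (p i) k) : PhiRA j -> PhiRA j) : s t / s + t}.
    by move=> s1 s2; exact: lactPhiDr.
  rewrite (morphD_sum _ _ D) (morphD_sum _ _ (Dr _)); apply: eq_bigr => l _.
  by rewrite mode_mx_pure lactPhiM.
rewrite /g (morphD_sum _ _ mode_mxD); apply/matrixP => k l.
rewrite summxE (bigD1 k) //= (morphD_sum _ _ mode_mxD) summxE (bigD1 l) //=.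
rewrite mode_mx_pure coords_basis eqxx mul1r pairing_lact bel coords_basis eqxx mulr1.
rewrite big1 ?addr0 => [|l' ll']; last first.
  rewrite mode_mx_pure coords_basis eqxx mul1r pairing_lact bel coords_basis.
  by rewrite (negPf ll') mulr0.
rewrite big1 ?addr0 // => k' kk'.
rewrite (morphD_sum _ _ mode_mxD) summxE big1 // => l' _.
by rewrite mode_mx_pure coords_basis eq_sym (negPf kk') mul0r.
Qed.

Lemma mode_algebra_iso_basis : mode_algebra_iso V j 'M[A]_n.
Proof.
have add : GRing.zmod_morphism mode_mx.
  move=> s t; apply: (addIr (mode_mx t)).
  by rewrite -mode_mxD !subrK.
pose fA := GRing.isZmodMorphism.Build (frakA V j j) 'M[A]_n mode_mx add.
pose f : {additive frakA V j j -> 'M[A]_n} := HB.pack mode_mx fA.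
by exists f; split; [exact: mode_mx_bij|exact: mode_mxM].
Qed.
End Coordinates.

(** * The rank of Phi^L(A)_j, by evaluation on the vacuum *)

Section Vacuum.
Variables (C : numFieldType) (V : voa C).
Local Notation A := (zhu V 0).
Local Notation PhiLA := (PhiL (@lactA C V)).
Local Notation PhiRA := (PhiR (@ractA C V)).
Local Notation vac := (vac : V).

Lemma uactZr (x : ufin V) c v : uact x (c *: v) = c *: uact x v.
Proof. exact: tactZ. Qed.

Lemma UactZr (x : UU V) c v : Uact x (c *: v) = c *: Uact x v.
Proof.
have [s [cs ->]] := ulim_surj x; have [w hw] := cseq_stab v cs.
rewrite (UactE _ hw); apply: UactE; have [n h] := hw.
by exists n => p /h <-; exact: uactZr.
Qed.

(** [UU] is only given a ring structure; complex scalars enter it as constant sequences. *)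
Definition Usc (c : C) : UU V := hlim (cauchy_cst (uhom_sc V c)).

Lemma Usc_hom c : Uhom 0 (Usc c). Proof. by eexists _, _. Qed.

Lemma Uact_sc c v : Uact (Usc c) v = c *: v.
Proof. by rewrite /Usc Uact_cst uactE. Qed.

Lemma Vdeg_vac : Vdeg 0 vac.
Proof. by have [x ->] := vac_deg V; exact: (Vdeg_inj x). Qed.

(** If vac = 0, then b = vac_(-1) b = 0 for all b, against dim V_0 = 1. *)
Lemma vac_neq0 : vac != 0.
Proof.
apply/eqP => v0; have V0 (b : V) : b = 0.
  by have := md_vac (-1) b; rewrite eqxx v0 md0l.
have := dim_piece0 V; suff -> : {: piece V 0}%VS = 0%VS by rewrite dimv0.
apply/eqP; rewrite -subv0; apply/subvP => x _; rewrite memv0.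
by rewrite -(injK x) (V0 (inj 0 x)) linear0.
Qed.

Lemma degree0_vac v : Vdeg 0 v -> exists c : C, v = c *: vac.
Proof.
move=> /(@VdegE C V 0) <-; set y := proj 0%N v.
have [x vacx] := vac_deg V.
have x0 : x != 0 by apply: contra_neq vac_neq0 => x0; rewrite vacx x0 linear0.
have : y \in <[x]>%VS.
  suff -> : <[x]>%VS = {: piece V 0}%VS by exact: memvf.
  by apply/eqP; rewrite eqEdim subvf dim_piece0 dim_vline x0.
by move=> /vlineP [c ->]; exists c; rewrite vacx linearZ.
Qed.

(* V_0 = C vac is a one-dimensional A-module; [chi] is its character. *)
Lemma vac_character : exists chi : A -> C,
  forall x, Uhom 0 x -> Uact x vac = chi (zcl 0 x) *: vac.
Proof.
have ex (a : A) : exists e : C,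
    forall x, Uhom 0 x -> zcl 0 x = a -> Uact x vac = e *: vac.
  have [x hx <-] := zcl_surj a.
  have [e he] := degree0_vac (Uact_Vdeg hx Vdeg_vac); exists e => y hy.
  rewrite -he => /(zclE 0 hy hx) xy; apply: subr0_eq; rewrite -UactBl.
  exact: (Lid_kill xy Vdeg_vac).
by have [chi h] := choice ex; exists chi => x hx; exact: h.
Qed.

Section Evaluation.
Variable j : nat.

(* the composite Phi^L(A)_j -> Phi^L(V_0)_j -> V_j *)
Lemma vac_eval : exists phi : {additive PhiLA j -> V},
  forall u, Uhom j%:Z u -> phi (clL j u) = Uact u vac.
Proof.
have ex (p : PhiLA j) : exists v : V,
    forall u, Uhom j%:Z u -> clL j u = p -> Uact u vac = v.
  have [w hw <-] := clL_surj p; exists (Uact w vac) => u hu uw.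
  apply: subr0_eq; rewrite -UactBl; apply: (@Lid_kill C V 1 j%:Z _ 0) => //.
    apply/clL_eq0; first exact: (subgroupB (Uhom_subgroup V j%:Z)).
    apply: (addIr (clL j w)); rewrite -clLD ?subrK ?add0r //.
    exact: (subgroupB (Uhom_subgroup V j%:Z)).
  exact: Vdeg_vac.
have [phi h] := choice ex.
have hphi u : Uhom j%:Z u -> phi (clL j u) = Uact u vac.
  by move=> hu; rewrite (h (clL j u) u).
have add : GRing.zmod_morphism phi.
  move=> p q; apply: (addIr (phi q)); rewrite subrK.
  have [u hu uE] := clL_surj (p - q); have [w hw wE] := clL_surj q.
  have pE : p = clL j (u + w) by rewrite clLD // uE wE subrK.
  by rewrite -uE -wE pE !hphi ?UactDl //; exact: UhomD.
pose fA := GRing.isZmodMorphism.Build (PhiLA j) V phi add.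
by exists (HB.pack_for {additive PhiLA j -> V} phi fA).
Qed.

Variables (n : nat) (b : 'I_n -> PhiLA j) (c : PhiLA j -> 'I_n -> A).
Hypothesis bc : basis_coords b c.
Hypothesis unital : strongly_unital V j.
Hypothesis V_gen0 : generated_in_degree0 V.

(** As V_0 = C vac, the second factor of each tensor of Phi^L(V_0)_j is a scalar times vac, and the
    scalar can be absorbed into the first factor. *)
Lemma generated_by_vac (y : piece V j) :
  exists2 u, Uhom j%:Z u & Uact u vac = inj j y.
Proof.
have [t <-] := V_gen0 y; have [m [p [q ->]]] := tensor_sum t.
have D : {morph @natmap C V j : s t / s + t}.
  exact: tliftD (@natmap_balanced C V j).
rewrite (morphD_sum _ _ D).
have ex i : exists u, Uhom j%:Z u /\
    Uact u vac = natmap (pure (@ractL C V j) (@lactV0 C V) (p i) (q i)).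
  have [u [hu ->]] := lcl_ex (p i); rewrite natmapE /=.
  have [e ->] := degree0_vac (Vdeg_inj (q i)).
  exists (u * Usc e); split; first exact: UhomM_eq (addr0 _) hu (Usc_hom e).
  by rewrite UactM Uact_sc.
have [u hu] := choice ex; exists (\sum_i u i).
  by apply: Uhom_sum => i; case: (hu i).
have Du : {morph (fun x : UU V => Uact x vac) : x y / x + y}.
  by move=> x z; exact: UactDl.
by rewrite (morphD_sum _ _ Du); apply: eq_bigr => i _; case: (hu i).
Qed.

(* The dual basis detects the coordinates of an element of Phi^L(A)_j modulo
   the kernel of the character, hence Phi^L(V_0)_j -> V_j is injective. *)
Lemma rank_dim_piece : \dim {: piece V j} = n.
Proof.
have [chi hchi] := vac_character; have [phi hphi] := vac_eval.
have phiM p a : phi (ractPhi p a) = chi a *: phi p.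
  have [u hu <-] := clL_surj p; have [x hx <-] := zcl_surj a.
  rewrite -clLM // hphi; last exact: UhomM_eq (addr0 _) hu hx.
  by rewrite UactM hchi // UactZr hphi.
(* For p and q represented by u and v, u vac = 0 gives v u vac = 0, so the character vanishes on
   [v u] = <q, p>. *)
have phi_inj p : phi p = 0 -> forall q, chi (pairing q p) = 0.
  move=> p0 q; have [u hu pu] := clL_surj p; have [v hv <-] := clR_surj q.
  rewrite -pu pairing_cl //; have hvu := UhomM_eq (addNr _) hv hu.
  have : chi (zcl 0 (v * u)) *: vac = 0.
    by rewrite -hchi // UactM -hphi // pu p0 Uact0r.
  by move=> /eqP; rewrite scaler_eq0 (negPf vac_neq0) orbF => /eqP.
have chi_sc e : chi (zcl 0 (Usc e)) = e.
  have := hchi _ (Usc_hom e); rewrite Uact_sc => /eqP.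
  rewrite -subr_eq0 -scalerBl scaler_eq0 (negPf vac_neq0) orbF subr_eq0.
  by move=> /eqP.
pose z k := proj j (phi (b k)).
have zE k : inj j (z k) = phi (b k).
  have [u hu bu] := clL_surj (b k); apply: VdegE; rewrite -bu hphi //.
  by have := Uact_Vdeg hu Vdeg_vac; rewrite addr0.
pose X := [tuple z k | k < n].
have XE (k : 'I_n) : X`_k = z k by rewrite -tnth_nth tnth_mktuple.
have [be [bel _]] := coords_dual bc unital.
(* A relation with coefficients e_k lifts to p = \sum_k b_k e_k with phi(p) = 0. Its coordinate
   <be_k, p> is the scalar e_k, on which the character vanishes, so e_k = 0. *)
have freeX : free X.
  apply/freeP => e e0 k; rewrite -(chi_sc (e k)).
  pose p := \sum_k ractPhi (b k) (zcl 0 (Usc (e k))).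
  rewrite -[zcl _ _](coords_uniq bc (fun k => zcl 0 (Usc (e k)))) -bel.
  apply: phi_inj; rewrite raddf_sum.
  have := congr1 (inj j) e0; rewrite linear_sum linear0 => {2}<-.
  by apply: eq_bigr => i _; rewrite phiM chi_sc linearZ XE /= zE.
suff : basis_of {: piece V j}%VS X by apply: size_basis.
rewrite basisEdim.
have -> : (size X <= \dim {: piece V j})%N.
  by move: freeX; rewrite /free => /eqP <-; exact: dimvS (subvf _).
rewrite andbT; apply/subvP => v _; have [u hu uv] := generated_by_vac v.
(* Spanning: v is the image of the class of [u], whose expansion in [b] is pushed through [phi]. *)
have <- : \sum_k chi (c (clL j u) k) *: z k = v.
  rewrite -(injK v) -uv -hphi // {2}(coords_sum bc (clL j u)) raddf_sum linear_sum.
  by apply: eq_bigr => k _; rewrite phiM linearZ.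
apply: memv_suml => k _; apply: memvZ; apply: memv_span.
by rewrite -XE mem_nth // size_tuple.
Qed.
End Evaluation.
End Vacuum.

(** * The level-d Zhu algebra acting on the modules Phi^L(A)_j *)

Section ZhuAction.
Variables (C : numFieldType) (V : voa C).
Local Notation A := (zhu V 0).
Local Notation PhiLA := (PhiL (@lactA C V)).
Local Notation Lid := (@Lid C V).
Local Notation Uhom := (@Uhom C V).

Lemma clLE j u v : Uhom j%:Z u -> Uhom j%:Z v ->
  clL j u = clL j v <-> Lid 1 j%:Z (u - v).
Proof.
move=> hu hv; have huv := subgroupB (Uhom_subgroup V j%:Z) hu hv.
rewrite -(clL_eq0 huv) -{1}(subrK v u) clLD //.
by split=> [e|->]; [apply: (addIr (clL j v)); rewrite e|]; rewrite add0r.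
Qed.

Lemma clRE j u v : Uhom (- j%:Z) u -> Uhom (- j%:Z) v ->
  clR j u = clR j v -> Lid (1 + j%:Z) (- j%:Z) (u - v).
Proof.
move=> hu hv; have huv := subgroupB (Uhom_subgroup V (- j%:Z)) hu hv.
rewrite -{1}(subrK v u) clRD // => e; apply: clR_eq0 => //.
by apply: (addIr (clR j v)); rewrite e add0r.
Qed.

Lemma clL_mull j x u v : Uhom 0 x -> Uhom j%:Z u -> Uhom j%:Z v ->
  clL j u = clL j v -> clL j (x * u) = clL j (x * v).
Proof.
move=> hx hu hv /clLE uv; apply/clLE; try exact: UhomM_eq (add0r _) hx _.
by rewrite -mulrBr; apply: Lid_mull_eq (add0r _) hx _; exact: uv.
Qed.

(** Right multiplication by degree j lowers the threshold from i to i - j, which is still at least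
    1. *)
Lemma clL_mul_Lid j (i : int) x u : (j%:Z < i)%R -> Lid i 0 x -> Uhom j%:Z u ->
  clL j (x * u) = 0.
Proof.
move=> ij hx hu; apply/clL_eq0; first exact: UhomM_eq (add0r _) hx.1 hu.
apply: (@LidS _ _ _ (i - j%:Z)); first by lia.
exact: Lid_mulr_eq (erefl _) (add0r _) hu hx.
Qed.

(* With 1_j = \sum_i u_i v_i, any x in U U_{<= - j} satisfies
   x = \sum_i x u_i v_i modulo U U_{<= - j - 1}. *)
Lemma Lid_faithful j x : strongly_unital V j -> Lid j%:Z 0 x ->
  (forall u, Uhom j%:Z u -> clL j (x * u) = 0) -> Lid (j%:Z + 1) 0 x.
Proof.
move=> /strongly_unital_dual_bases [n [p [q [_ qE]]]] hx x0.
have [u hu] := clL_lift p.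
have [v hv] := clR_lift q.
pose e := \sum_i u i * v i.
have huv i : Uhom 0 (u i * v i).
  exact: UhomM_eq (subrr _) (hu i).1 (hv i).1.
have he : Uhom 0 e by exact: Uhom_sum.
(* [e] represents 1_j: by the dual basis property in Phi^R(A)_{-j}, it is a right unit on degree
   -j. *)
have re w : Uhom (- j%:Z) w -> Lid (1 + j%:Z) (- j%:Z) (w - w * e).
  move=> hw; apply: clRE => //; first exact: UhomM_eq (addr0 _) hw he.
  rewrite (qE (clR j w)) mulr_sumr.
  have hwu i : Uhom 0 (w * u i).
    exact: UhomM_eq (addNr _) hw (hu i).1.
  rewrite clR_sum => [|i]; last exact: UhomM_eq (addr0 _) hw (huv i).
  apply: eq_bigr => i _; have [hui <-] := hu i; have [hvi <-] := hv i.
  by rewrite mulrA clRM // pairing_cl.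
have [m [s [t [st hr]]]] := Lid_decomp hx.
set r := x - _ in hr; have xE : x = r + \sum_i s i * t i by rewrite subrK.
(* The first two terms add up to x - x e and the last one is x e. There [x * u i] lies in [Lid 1 j]
   since x kills Phi^L(A)_j, and multiplying by [v i] raises the threshold to j + 1. *)
have -> : x = (r - r * e) + \sum_i s i * (t i - t i * e) + \sum_i x * u i * v i.
  have -> : \sum_i x * u i * v i = x * e.
    by rewrite mulr_sumr; apply: eq_bigr => i _; rewrite mulrA.
  have -> : \sum_i s i * (t i - t i * e) = \sum_i s i * t i - (\sum_i s i * t i) * e.
    by rewrite mulr_suml -sumrB; apply: eq_bigr => i _; rewrite mulrBr mulrA.
  by rewrite addrACA -xE -opprD -mulrDl -xE subrK.
have sL := Lid_subgroup V (j%:Z + 1) 0.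
apply: (subgroupD sL); first apply: (subgroupD sL).
- by apply: (subgroupB sL) => //; exact: Lid0_mulr.
- apply: (subgroup_sum sL) => i; have [hs ht] := st i.
  apply: Lid_mull_eq (subrr _) hs _; rewrite addrC; exact: re.
apply: (subgroup_sum sL) => i; have [hui _] := hu i; have [hvi _] := hv i.
apply: (Lid_mulr_eq _ (subrr _) hvi (m := 1)); first by rewrite opprK addrC.
apply/clL_eq0; last exact: x0.
exact: UhomM_eq (add0r _) hx.1 hui.
Qed.

Section Matrix.
Variables (j n : nat) (b : 'I_n -> PhiLA j) (c : PhiLA j -> 'I_n -> A).
Hypothesis bc : basis_coords b c.
Variable d : nat.
Hypothesis le_jd : (j <= d)%N.

(** Left multiplication by U_0 commutes with the right action of A, so it is given by a matrix:
    column l holds the coordinates of x w_l, for w_l representing b_l. *)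
Lemma zhu_action : exists f : {rmorphism zhu V d -> 'M[A]_n},
  forall x u k, Uhom 0 x -> Uhom j%:Z u ->
    c (clL j (x * u)) k = \sum_l f (zcl d x) k l * c (clL j u) l.
Proof.
have [w hw] := clL_lift b.
pose F x : 'M[A]_n := \matrix_(k, l) c (clL j (x * w l)) k.
have hxw x l : Uhom 0 x -> Uhom j%:Z (x * w l).
  by move=> hx; exact: UhomM_eq (add0r _) hx (hw l).1.
have FE x u k : Uhom 0 x -> Uhom j%:Z u ->
    c (clL j (x * u)) k = \sum_l F x k l * c (clL j u) l.
  move=> hx hu.
  have [a ha] := zcl_lift (c (clL j u)).
  have hwa l : Uhom j%:Z (w l * a l).
    exact: UhomM_eq (addr0 _) (hw l).1 (ha l).1.
  (* Lifting the coordinates of the class of u to a_l in U_0, u may be replaced by \sum_l w_l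
     a_l. *)
  have -> : clL j (x * u) = clL j (x * \sum_l w l * a l).
    apply: clL_mull => //; first exact: Uhom_sum.
    rewrite clL_sum // {1}(coords_sum bc (clL j u)); apply: eq_bigr => l _.
    by have [hwl <-] := hw l; have [hal <-] := ha l; rewrite clLM.
  rewrite mulr_sumr clL_sum => [|l]; last exact: UhomM_eq (add0r _) hx (hwa l).
  rewrite (coords_lin bc); apply: eq_bigr => l _; have [hal <-] := ha l.
  by rewrite mulrA clLM ?(coordsM bc) ?mxE //; exact: hxw.
(* [F] factors through level d: [Lid (d + 1) 0] acts by zero in degree j, as j < d + 1. *)
have ex (a : zhu V d) : exists M, forall x, Uhom 0 x -> zcl d x = a -> F x = M.
  have [x hx <-] := zcl_surj a; exists (F x) => y hy /(zclE d hy hx) yx.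
  apply/matrixP => k l; rewrite !mxE; congr (c _ k); apply/clLE; try exact: hxw.
  rewrite -mulrBl; apply/clL_eq0; first exact: hxw (subgroupB (Uhom_subgroup V 0) hy hx).
  by apply: clL_mul_Lid yx _; [lia|case: (hw l)].
have [f hf] := choice ex.
have fE x : Uhom 0 x -> f (zcl d x) = F x by move=> hx; rewrite (hf (zcl d x) x).
have fD a a' : f (a + a') = f a + f a'.
  have [x hx <-] := zcl_surj a; have [y hy <-] := zcl_surj a'.
  rewrite -zclD // !fE //; last exact: UhomD.
  by apply/matrixP => k l; rewrite !mxE mulrDl clLD ?(coordsD bc) //; exact: hxw.
have add : GRing.zmod_morphism f.
  by move=> a a'; apply: (addIr (f a')); rewrite -fD !subrK.
have mul : GRing.monoid_morphism f.
  split=> [|a a'].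
    rewrite -zcl1 fE; last exact: Uhom1.
    apply/matrixP => k l; rewrite !mxE mul1r; have [_ ->] := hw l.
    exact: (coords_basis bc).
  have [x hx <-] := zcl_surj a; have [y hy <-] := zcl_surj a'.
  rewrite -zclM // !fE //; last exact: Uhom0M.
  apply/matrixP => k l; rewrite mxE -mulrA FE //; last exact: hxw.
  by rewrite mxE; apply: eq_bigr => m _; rewrite [F y m l]mxE.
pose fA := GRing.isZmodMorphism.Build (zhu V d) 'M[A]_n f add.
pose fM := GRing.isMonoidMorphism.Build (zhu V d) 'M[A]_n f mul.
pose g : {rmorphism zhu V d -> 'M[A]_n} := HB.pack f fA fM.
by exists g => x u k hx hu; rewrite /= fE //; exact: FE.
Qed.

Hypothesis unital : strongly_unital V j.

(** Take x = \sum_l m_l v_l, with m_l representing column l of M and v_l the dual basis vector be_l: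
    then x b_l is the class of m_l. Since the v_l have degree -j, x lies in [Lid j 0]. *)
Lemma zhu_action_onto (f : zhu V d -> 'M[A]_n) :
  (forall x u k, Uhom 0 x -> Uhom j%:Z u ->
    c (clL j (x * u)) k = \sum_l f (zcl d x) k l * c (clL j u) l) ->
  forall M, exists2 x, Lid j%:Z 0 x & f (zcl d x) = M.
Proof.
move=> hf M; have [be [bel _]] := coords_dual bc unital.
have [v hv] := clR_lift be.
have [m hm] := clL_lift (fun l => \sum_k ractPhi (b k) (M k l)).
have hmv l : Lid j%:Z 0 (m l * v l).
  apply: Lid_mull_eq (subrr _) (hm l).1 _; apply: Lid_full (hv l).1.
  by rewrite opprK.
pose x := \sum_l m l * v l.
have hx : Lid j%:Z 0 x by exact: (subgroup_sum (Lid_subgroup V _ _)).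
exists x => //; apply/matrixP => k l.
have [u hu ul] := clL_surj (b l).
have := hf x u k hx.1 hu; rewrite ul (bigD1 l) //= (coords_basis bc) eqxx mulr1.
rewrite big1 ?addr0 => [<-|l' ll']; last by rewrite (coords_basis bc) (negPf ll') mulr0.
have hvu l' : Uhom 0 (v l' * u) by exact: UhomM_eq (addNr _) (hv l').1 hu.
rewrite /x mulr_suml; under eq_bigr => l' _ do rewrite -mulrA.
rewrite clL_sum => [|l']; last exact: UhomM_eq (addr0 _) (hm l').1 (hvu l').
have E l' : c (clL j (m l' * (v l' * u))) k = M k l' * (l' == l)%:R.
  have [hml mE] := hm l'; have [hvl vE] := hv l'.
  by rewrite clLM // (coordsM bc) mE (coords_uniq bc) -(pairing_cl hvl hu) vE ul bel
    (coords_basis bc).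
rewrite (coords_lin bc) (bigD1 l) //= E eqxx mulr1 big1 ?addr0 // => l' ll'.
by rewrite E (negPf ll') mulr0.
Qed.
End Matrix.

Hypothesis V_gen0 : generated_in_degree0 V.
Hypothesis A_comm : forall x y : A, x * y = y * x.
Hypothesis A_proj : forall M : lmodType A, projective M -> free_module M.

Lemma PhiL_basis_piece j : strongly_unital V j ->
  exists (b : 'I_(\dim {: piece V j}) -> PhiLA j) c, basis_coords b c.
Proof.
move=> unital; have [n [b [c bc]]] := PhiL_basis A_comm A_proj unital.
by rewrite (rank_dim_piece bc unital V_gen0); exists b, c.
Qed.

Lemma zhu_prod d : (forall j, (j <= d)%N -> strongly_unital V j) ->
  iso_to_prod (zhu V d) (fun j : 'I_d.+1 => 'M[A]_(\dim {: piece V j})).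
Proof.
move=> unital.
have ex (j : 'I_d.+1) : exists f : {rmorphism zhu V d -> 'M[A]_(\dim {: piece V j})},
    [/\ forall x, Uhom 0 x -> f (zcl d x) = 0 ->
          forall u, Uhom j%:Z u -> clL j (x * u) = 0,
        forall M, exists2 x, Lid j%:Z 0 x & f (zcl d x) = M
      & forall (i : nat) x, (j < i)%N -> Lid i%:Z 0 x -> f (zcl d x) = 0].
  have jd : (j <= d)%N by rewrite -ltnS.
  have [b [c bc]] := PhiL_basis_piece (unital j jd).
  have [f hf] := zhu_action bc jd; exists f; split.
  - move=> x hx fx0 u hu; rewrite (coords_sum bc (clL j (x * u))) big1 // => k _.
    rewrite hf // fx0 big1 => [|l _]; last by rewrite mxE mul0r.
    by apply: (addrI (ractPhi (b k) 0)); rewrite -ractPhiDr !addr0.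
  - exact (zhu_action_onto bc (unital j jd) hf).
  - move=> i x ji hx; apply/matrixP => k l; rewrite mxE.
    have [u hu ul] := clL_surj (b l); have := hf x u k hx.1 hu.
    rewrite (@clL_mul_Lid j i%:Z) // ul (bigD1 l) //= big1 => [|m ml]; last first.
      by rewrite (coords_basis bc) (negPf ml) mulr0.
    rewrite (coords_basis bc) eqxx mulr1 addr0 => <-.
    by apply: (addrI (c 0 k)); rewrite -(coordsD bc) !addr0.
pose f j := projT1 (cid (ex j)); have hf j := projT2 (cid (ex j)).
exists f => y.
(* Components are corrected in increasing degree: the correction at m lies in [Lid m 0], hence acts
   by zero on every i < m and leaves the earlier components intact. *)
have onto (m : nat) : (m <= d.+1)%N ->
    exists2 x, Uhom 0 x & forall i : 'I_d.+1, (i < m)%N -> f i (zcl d x) = y i.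
  elim: m => [_|m IH md]; first by exists 0 => //; exact: subgroup0 (Uhom_subgroup V 0).
  have [x hx xE] := IH (ltnW md); pose k := Ordinal md.
  have [_ /(_ (y k - f k (zcl d x))) [z hz zE] _] := hf k.
  exists (x + z) => [|i]; first exact: UhomD hz.1.
  rewrite zclD ?rmorphD //; last exact: hz.1.
  rewrite ltnS leq_eqVlt => /orP[/eqP im|im]; last first.
    have [_ _ /(_ m z im hz)] := hf i; rewrite -/(f i) => ->.
    by rewrite addr0 xE.
  have -> : i = k by exact: val_inj.
  by rewrite [X in _ + X]zE addrC subrK.
have [x hx xE] := onto d.+1 (leqnn _); exists (zcl d x); split=> [i|a aE].
  exact: xE.
have [z hz za] := zcl_surj a.
have hxz := subgroupB (Uhom_subgroup V 0) hx hz.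
suff : zcl d (x - z) = 0.
  by move=> e; rewrite -(subrK z x) zclD // e add0r za.
have f0 i : f i (zcl d (x - z)) = 0.
  apply: (addIr (f i (zcl d z))); rewrite -rmorphD -zclD // subrK add0r.
  by rewrite za aE xE.
(* Uniqueness: x - z climbs through the filtration from [Lid 0 0], which is all of U_0, to
   [Lid (d + 1) 0], the ideal defining level d. *)
suff kill (m : nat) : (m <= d.+1)%N -> Lid m%:Z 0 (x - z).
  apply/zcl_eq0 => //; have -> : d%:Z + 1 = d.+1%:Z by lia.
  exact: kill.
elim: m => [_|m IH md]; first exact: Lid_full.
have -> : m.+1%:Z = m%:Z + 1 by lia.
apply: Lid_faithful; [exact: unital|exact: IH (ltnW md)|].
by have [h _ _] := hf (Ordinal md); apply: h => //; exact: f0.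
Qed.
End ZhuAction.

Theorem corollary5p0p2 (R : realType) (V : voa R[i]) (d : nat)
  (V_simple : simple_voa V)
  (V_gen0 : generated_in_degree0 V)
  (d_gt0 : (0 < d)%N)
  (V_nonexc : forall j : nat, (j <= d)%N -> non_exceptional V j)
  (V_unital : forall j : nat, (j <= d)%N -> strongly_unital V j)
  (A_comm : forall x y : zhu V 0, x * y = y * x)
  (A_conn : connected_ring (zhu V 0))
  (A_noeth : noetherian (zhu V 0))
  (A_proj : forall M : lmodType (zhu V 0), projective M -> free_module M) :
  (forall j : nat, (j <= d)%N ->
     mode_algebra_iso V j 'M[zhu V 0]_(\dim {: piece V j}))
  /\ iso_to_prod (zhu V d)
       (fun j : 'I_d.+1 => 'M[zhu V 0]_(\dim {: piece V j})).
Proof.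
split=> [j jd|]; last exact: zhu_prod.
have [b [c bc]] := PhiL_basis_piece V_gen0 A_comm A_proj (V_unital j jd).
exact: mode_algebra_iso_basis bc (V_unital j jd).
Qed.
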